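(* Let $q$ be a complex number with $|q|<1$ and let $z$ be a nonzero complex number such that no denominator below vanishes. Then \begin{align*} \sum_{k=-\infty}^\infty\frac{(-zq;q^2)_k}{(zq^2;q^2)_k}q^{k^2}z^k ={}&\frac{(-zq,1/z;q^2)_\infty}{(z^2q^2,1/z^2;q^2)_\infty}(q^8;q^8)_\infty \left[(z^4q^5,z^{-4}q^3;q^8)_\infty+z^{-1}(z^4q^3,z^{-4}q^5;q^8)_\infty\right],\\ \sum_{k=-\infty}^\infty\frac{(-zq;q^2)_k}{(zq^2;q^2)_k}q^{k(k+2)}z^k ={}&\frac{(-zq,1/z;q^2)_\infty}{(z^2q^2,1/z^2;q^2)_\infty}(q^8;q^8)_\infty \left[(z^4q^7,z^{-4}q;q^8)_\infty+z^{-3}(z^4q,z^{-4}q^7;q^8)_\infty\right]. \end{align*}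
   Context: For complex $a$ and $k\in\mathbb Z\cup\{\infty\}$ the $q$-shifted factorial is $(a;q)_0=1$, $(a;q)_k=\prod_{j=1}^k(1-aq^{j-1})$ for $k>0$ (including $k=\infty$, an infinite product), and $(a;q)_k=\prod_{j=1}^{-k}(1-aq^{-j})^{-1}$ for $k<0$. Also $(a_1,\dots,a_m;q)_k=(a_1;q)_k\cdots(a_m;q)_k$. *)

(* Defs.v *)
(* Complex numbers are [R[i]] (real_closed.complex) for [R : realType]. *)
From HB Require Import structures.
From mathcomp Require Export all_boot all_order all_algebra.
From mathcomp Require Export all_classical all_reals all_analysis.
From mathcomp Require Export complex.
Export Order.TTheory GRing.Theory Num.Theory.
Export numFieldNormedType.Exports.

Set Implicit Arguments.
Unset Strict Implicit.
Unset Printing Implicit Defensive.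

Local Open Scope classical_set_scope.
Local Open Scope ring_scope.

(* (a;q)_k for k : int; [Negz n] is the integer -(n+1), so the second product
   has the factors (1 - a q^{-j})^{-1}, j = 1, ..., n+1. *)
Definition qpoch (K : fieldType) (a q : K) (k : int) : K :=
  match k with
  | Posz n => \prod_(1 <= j < n.+1) (1 - a * q ^+ (j - 1))
  | Negz n => \prod_(1 <= j < n.+2) (1 - a * q ^- j)^-1
  end.

(* The denominators occurring in the (a;q)_k with k < 0 do not vanish. *)
Definition qpoch_neg_defined (K : fieldType) (a q : K) : Prop :=
  q != 0 /\ forall j : nat, (0 < j)%N -> 1 - a * q ^- j != 0.

(* (a;q)_oo; the limit exists whenever |q| < 1 and K is complete. *)
Definition qpoch_inf (K : numFieldType) (a q : K) : K :=
  limn (fun n : nat => \prod_(1 <= j < n.+1) (1 - a * q ^+ (j - 1))).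

(* (a_1, ..., a_m; q)_oo *)
Definition qpoch_infs (K : numFieldType) (s : seq K) (q : K) : K :=
  \prod_(a <- s) qpoch_inf a q.

(* The bilateral series converges with sum l: both halves, k >= 0 and k < 0,
   converge, and l is the sum of the two limits. *)
Definition bilateral_sum (K : numFieldType) (f : int -> K) (l : K) : Prop :=
  exists l1 l2 : K,
    [/\ series (fun n : nat => f (Posz n)) @ \oo --> l1,
        series (fun n : nat => f (Negz n)) @ \oo --> l2
      & l = l1 + l2].

(* Main.v *)
Require Import Defs.
From mathcomp Require Import ring lra zify.
Set Implicit Arguments.
Unset Strict Implicit.
Unset Printing Implicit Defensive.
Local Open Scope classical_set_scope.
Local Open Scope ring_scope.
Local Open Scope complex_scope.

(** Write p = -q, x = -z and s^2 = p. Multiplying the bilateral series by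
(zq^2;q^2)_oo (-q/z;q^2)_oo turns it into
  sum_k h(x p^(2k)) p^(2k(k+e)) x^(2k),   h(y) = (-y p^2, -p/y; p^2)_oo,
with e = 0 for the first identity and e = 1 for the second. Expanding the
truncations of h by the Gauss binomial theorem and collecting powers of x gives
  1/2 sum_(s = +-sqrt p) c(s) theta(s, x p^e),  theta(s, x) = sum_N s^(N^2) x^N,
where c(s) = sum_(a,b) s^((a+b)^2 + 2a) / ((p^2;p^2)_a (p^2;p^2)_b). The inner sum
over a + b = n is 1/(p;p)_n, so c(s) = (-s;p)_oo by Euler. By the Jacobi triple
product, (xp, 1/x; p)_oo (-s;p)_oo theta(s, x) is (s', x s', 1/x; s')_oo with
s' = -s, that is sum_j (-1)^j s'^(j(j+1)/2) x^j. Averaging over the two signs of s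
keeps only the terms with j = 0 or 3 modulo 4, which are the two theta series on
the right-hand side. All limits are taken by Tannery's theorem with geometric
majorants. *)

(** * Absolute values, geometric majorants and Tannery's theorem *)

(* A real-valued absolute value that induces the topology of K and makes
   geometrically dominated series converge; [R[i]] is the intended instance, and
   estimates then take place in R instead of the partially ordered K. *)
Record complete_abs (R : realType) (K : numFieldType) (nm : K -> R) : Prop :=
  CompleteAbs {
    nm_ge0 : forall x, 0 <= nm x;
    nm_eq0 : forall x, (nm x == 0) = (x == 0);
    nmM : forall x y, nm (x * y) = nm x * nm y;
    ler_nmD : forall x y, nm (x + y) <= nm x + nm y;
    nm_cvgP : forall (u : nat -> K) (l : K), u @ \oo --> l <->
      (forall e : R, 0 < e ->
         exists N, forall n, (N <= n)%N -> nm (u n - l) < e);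
    geometric_cvg : forall (u : nat -> K) (c r : R), 0 <= r < 1 ->
      (forall n, nm (u n) <= c * r ^+ n) -> cvgn (series u) }.

Lemma expr_small (R : realType) (c r e : R) : 0 <= r < 1 -> 0 < e ->
  exists N, forall n, (N <= n)%N -> c * r ^+ n < e.
Proof.
move=> /andP[r0 r1] e0.
have cv : (fun n => c * r ^+ n) @ \oo --> (0 : R).
  by apply: cvg_geometric; rewrite ger0_norm.
have /cvgrPdist_lt/(_ e e0) [N _ HN] := cv.
exists N => n Nn; have := HN n Nn; rewrite /= sub0r normrN.
exact/le_lt_trans/ler_norm.
Qed.

(** From some index N on, L r^n < r, so each step multiplies b by at most r. The constant c adds up
    b_i / r^i for i <= N and thereby covers the initial terms as well. *)
Lemma ratio_geometric (R : realType) (b : nat -> R) (L r : R) : 0 < r < 1 ->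
  (forall n, 0 <= b n) -> (forall n, b n.+1 <= L * r ^+ n * b n) ->
  exists c, forall n, b n <= c * r ^+ n.
Proof.
move=> /andP[r0 r1] b0 bS.
have [|N HN] := @expr_small R L r r _ r0; first by rewrite ltW.
pose c := \sum_(i < N.+1) b i / r ^+ i.
exists c; elim=> [|n IH]; last first.
  have [Nn|nN] := leqP N n.
    apply: le_trans (bS n) _; apply: (@le_trans _ _ (r * b n)).
      by rewrite ler_wpM2r ?b0 // ltW ?HN.
    by rewrite exprS mulrCA ler_wpM2l // ltW.
  rewrite -ler_pdivrMr ?exprn_gt0 // /c (bigD1 (Ordinal (nN : (n.+1 < N.+1)%N))) //=.
  by rewrite lerDl sumr_ge0 // => i _; rewrite divr_ge0 ?exprn_ge0 // ltW.
rewrite expr0 mulr1 /c big_ord_recl expr0 divr1 lerDl sumr_ge0 // => i _.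
by rewrite divr_ge0 ?exprn_ge0 // ltW.
Qed.

(** Follows from 1 + x <= exp x and the geometric series. The bound is uniform in n, which is what
    the majorants below need. *)
Lemma prod1D_geometric_le (R : realType) (c r : R) (n : nat) :
  0 <= c -> 0 <= r < 1 ->
  \prod_(j < n) (1 + c * r ^+ j) <= expR (c / (1 - r)).
Proof.
move=> c0 /andP[r0 r1].
apply: (@le_trans _ _ (expR (\sum_(j < n) c * r ^+ j))).
  rewrite expR_sum; apply: ler_prod => j _.
  by rewrite expR_ge1Dx andbT addr_ge0 // mulr_ge0 // exprn_ge0.
rewrite ler_expR -mulr_sumr ler_wpM2l //.
have r1' : 0 < 1 - r by rewrite subr_gt0.
rewrite -[leRHS]mul1r ler_pdivlMr // mulrC.
by rewrite -opprB mulNr -subrX1 opprB gerBl exprn_ge0.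
Qed.

Section Abs.
Variables (R : realType) (K : numFieldType) (nm : K -> R).
Hypothesis nmP : complete_abs nm.

Lemma nm0 : nm 0 = 0.
Proof. by apply/eqP; rewrite (nm_eq0 nmP). Qed.

Lemma nm1 : nm 1 = 1.
Proof.
have n1 : nm 1 != 0 by rewrite (nm_eq0 nmP) oner_eq0.
by apply: (mulfI n1); rewrite -(nmM nmP) !mulr1.
Qed.

Lemma nmN x : nm (- x) = nm x.
Proof.
suff nN1 : nm (- 1) = 1 by rewrite -mulN1r (nmM nmP) nN1 mul1r.
apply/eqP; rewrite -(@eqrXn2 _ 2) ?(nm_ge0 nmP) //.
by rewrite expr1n expr2 -(nmM nmP) mulrNN mulr1 nm1.
Qed.

Lemma nmV x : nm x^-1 = (nm x)^-1.
Proof.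
have [->|x0] := eqVneq x 0; first by rewrite invr0 nm0 invr0.
have n0 : nm x != 0 by rewrite (nm_eq0 nmP).
by apply: (mulfI n0); rewrite -(nmM nmP) !divff ?nm1.
Qed.

Lemma nmX x n : nm (x ^+ n) = nm x ^+ n.
Proof. by elim: n => [|n IH]; rewrite ?expr0 ?nm1 // !exprS (nmM nmP) IH. Qed.

Lemma nmXz x (k : int) : nm (x ^ k) = nm x ^ k.
Proof. by case: k => n; rewrite ?NegzE -?exprnN ?nmV -?exprnP nmX. Qed.

Lemma nm_gt0 x : x != 0 -> 0 < nm x.
Proof. by move=> x0; rewrite lt_def (nm_eq0 nmP) x0 (nm_ge0 nmP). Qed.

Lemma nm_prod I (s : seq I) (P : pred I) (F : I -> K) :
  nm (\prod_(i <- s | P i) F i) = \prod_(i <- s | P i) nm (F i).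
Proof. by apply: (big_morph nm (nmM nmP) nm1). Qed.

Lemma ler_nm_sum I (s : seq I) (P : pred I) (F : I -> K) :
  nm (\sum_(i <- s | P i) F i) <= \sum_(i <- s | P i) nm (F i).
Proof.
elim/big_rec2: _ => [|i y x _ H]; first by rewrite nm0.
by apply: le_trans (ler_nmD nmP _ _) _; rewrite lerD2l.
Qed.

Lemma nm_prod1B_le (a q : K) n : nm q < 1 ->
  nm (\prod_(j < n) (1 - a * q ^+ j)) <= \prod_(j < n) (1 + nm a * nm q ^+ j).
Proof.
move=> q1; rewrite nm_prod; apply: ler_prod => j _; rewrite (nm_ge0 nmP) /=.
by apply: le_trans (ler_nmD nmP _ _) _; rewrite nm1 nmN (nmM nmP) nmX.
Qed.

Lemma nm_lim_le (u : nat -> K) l (c : R) : u @ \oo --> l ->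
  (exists N, forall n, (N <= n)%N -> nm (u n) <= c) -> nm l <= c.
Proof.
move=> /(nm_cvgP nmP) ul [N uc]; rewrite leNgt; apply/negP => cl.
have [|M HM] := ul (nm l - c); first by rewrite subr_gt0.
have /HM := leq_maxr N M; have /uc := leq_maxl N M.
set x := u _ => xc xl.
have := ler_nmD nmP x (- (x - l)); rewrite nmN opprB addrC subrK => H.
by lra.
Qed.

Lemma geometric_tail (u : nat -> K) l (c r : R) n : 0 <= r < 1 ->
  (forall n, nm (u n) <= c * r ^+ n) -> series u @ \oo --> l ->
  nm (l - series u n) <= c / (1 - r) * r ^+ n.
Proof.
move=> /andP[r0 r1] uc ul.
have c0 : 0 <= c by have := uc 0%N; rewrite expr0 mulr1; apply/le_trans/(nm_ge0 nmP).
have r1' : 0 < 1 - r by rewrite subr_gt0.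
(* Keeping the exact difference r^n - r^(n+m) makes the induction on m close. *)
have part m : nm (series u (n + m)%N - series u n) <= c / (1 - r) * (r ^+ n - r ^+ (n + m)).
  elim: m => [|m IH]; first by rewrite addn0 !subrr nm0 mulr0.
  rewrite addnS seriesSr addrAC; apply: le_trans (ler_nmD nmP _ _) _.
  apply: le_trans (lerD IH (uc _)) _.
  have -> : c * r ^+ (n + m) = c / (1 - r) * (r ^+ (n + m) - r ^+ (n + m).+1).
    by rewrite exprS; field; rewrite gt_eqF.
  by rewrite -mulrDr [X in _ * X](_ : _ = r ^+ n - r ^+ (n + m).+1) //; ring.
have cv : (fun m => series u m - series u n) @ \oo --> l - series u n.
  by apply: cvgB => //; apply: cvg_cst.
apply: (nm_lim_le cv); exists n => m nm_.
rewrite -(subnKC nm_); apply: le_trans (part _) _.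
by apply: ler_wpM2l; [rewrite divr_ge0 // ltW | rewrite gerBl exprn_ge0].
Qed.

(** Tannery's theorem, that is, dominated convergence for series. The difference l M - lv splits
    into two tails beyond N and a difference of partial sums of fixed length N, which tends to 0
    termwise. *)
Lemma tannery (u : nat -> nat -> K) (v : nat -> K) (l : nat -> K) (c r : R) :
  0 <= r < 1 -> (forall M n, nm (u M n) <= c * r ^+ n) ->
  (forall n, (fun M => u M n) @ \oo --> v n) ->
  (forall M, series (u M) @ \oo --> l M) ->
  exists2 lv : K, series v @ \oo --> lv & l @ \oo --> lv.
Proof.
move=> r01 uc uv ul.
have vc n : nm (v n) <= c * r ^+ n by apply: (nm_lim_le (uv n)); exists 0%N.
have /cvg_ex[lv vl] : cvgn (series v) by apply: (geometric_cvg nmP r01 vc).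
exists lv => //; apply/(nm_cvgP nmP) => e e0.
have e3 : 0 < e / 3 by rewrite divr_gt0.
(* Since u and v share the majorant, this one N makes both tails smaller than e / 3, uniformly in
   M. *)
have [N HN] := expr_small (c / (1 - r)) r01 e3.
have cvN : (fun M => series (u M) N) @ \oo --> series v N.
  rewrite /series /=; elim: N {HN} => [|N IH].
    under eq_fun do rewrite big_geq //; rewrite big_geq //; exact: cvg_cst.
  under eq_fun do rewrite big_nat_recr //=; rewrite big_nat_recr //=.
  exact: cvgD.
have [N' HN'] := (nm_cvgP nmP _ _).1 cvN _ e3.
exists N' => M N'M.
have h1 := geometric_tail N r01 (uc M) (ul M).
have h2 := geometric_tail N r01 vc vl.
have h3 := HN _ (leqnn N); have h4 := HN' _ N'M.
have -> : l M - lv = (l M - series (u M) N) + ((series (u M) N - series v N) - (lv - series v N)).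
  by ring.
have := ler_nmD nmP (l M - series (u M) N) ((series (u M) N - series v N) - (lv - series v N)).
have := ler_nmD nmP (series (u M) N - series v N) (- (lv - series v N)).
rewrite nmN; lra.
Qed.

End Abs.

(** * Finite q-products *)

(** The finite (a;q)_n with factors indexed from 0, free of the shift by one in [qpoch]. *)
Definition qprod (K : fieldType) (a q : K) (n : nat) : K :=
  \prod_(j < n) (1 - a * q ^+ j).

Section QprodAlgebra.
Variable K : fieldType.
Implicit Types (a q : K) (n m : nat).

Lemma qprod0 a q : qprod a q 0 = 1.
Proof. by rewrite /qprod big_ord0. Qed.

Lemma qprodS a q n : qprod a q n.+1 = qprod a q n * (1 - a * q ^+ n).
Proof. by rewrite /qprod big_ord_recr. Qed.

Lemma qprodD a q n m : qprod a q (n + m) = qprod a q n * qprod (a * q ^+ n) q m.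
Proof.
elim: m => [|m IH]; first by rewrite addn0 qprod0 mulr1.
by rewrite addnS !qprodS IH exprD -!mulrA.
Qed.

Lemma qprodSl a q n : qprod a q n.+1 = (1 - a) * qprod (a * q) q n.
Proof. by rewrite -add1n qprodD qprodS qprod0 mul1r expr0 mulr1 expr1. Qed.

(** Separates the factors with even and odd powers of q. *)
Lemma qprod_dissect a q n :
  qprod a q n.*2 = qprod a (q ^+ 2) n * qprod (a * q) (q ^+ 2) n.
Proof.
elim: n => [|n IH]; first by rewrite !qprod0 mulr1.
by rewrite doubleS !qprodS IH -mul2n [q ^+ (2 * n).+1]exprS exprM; ring.
Qed.

Lemma qprod_sqr a q n :
  qprod a q n * qprod (- a) q n = qprod (a ^+ 2) (q ^+ 2) n.
Proof.
rewrite /qprod -big_split /=; apply: eq_bigr => j _.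
by rewrite -exprM mulnC exprM; ring.
Qed.

Lemma qpoch_pos a q n : qpoch a q (Posz n) = qprod a q n.
Proof.
rewrite /qpoch /qprod big_add1 big_mkord.
by apply: eq_bigr => j _; rewrite subn1.
Qed.

End QprodAlgebra.

(** * Infinite products and bilateral sums *)

Section Limits.
Variables (R : realType) (K : numFieldType) (nm : K -> R).
Hypothesis nmP : complete_abs nm.

Lemma subseq_cvg (u : nat -> K) (f : nat -> nat) (l : K) :
  (forall n, n <= f n)%N -> u @ \oo --> l -> (fun n => u (f n)) @ \oo --> l.
Proof.
move=> fn /(nm_cvgP nmP) ul; apply/(nm_cvgP nmP) => e /ul[N HN].
by exists N => n Nn; apply: HN; exact: leq_trans (fn n).
Qed.

Lemma cvg_uniq (u : nat -> K) (a b : K) :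
  u @ \oo --> a -> u @ \oo --> b -> a = b.
Proof. by move=> ua ub; rewrite -(cvg_lim _ ua) // -(cvg_lim _ ub). Qed.

Lemma nm_qprod_le (a q : K) n : nm q < 1 ->
  nm (qprod a q n) <= expR (nm a / (1 - nm q)).
Proof.
move=> q1; apply: le_trans (nm_prod1B_le nmP _ _ q1) _.
by apply: prod1D_geometric_le; rewrite ?(nm_ge0 nmP).
Qed.

(** Consecutive partial products differ by -a q^n (a;q)_n. The products are bounded, so these
    increments are geometrically small and their telescoping series converges. *)
Lemma qpoch_inf_cvg (a q : K) : nm q < 1 ->
  (fun n => qprod a q n) @ \oo --> qpoch_inf a q.
Proof.
move=> q1; rewrite /qpoch_inf.
have E : (fun n => \prod_(1 <= j < n.+1) (1 - a * q ^+ (j - 1))) = qprod a q.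
  by apply/funext => n; exact: qpoch_pos.
rewrite E.
pose u n := - (a * q ^+ n * qprod a q n).
have Su n : series u n = qprod a q n - 1.
  elim: n => [|n IH]; first by rewrite /series /= big_geq // qprod0 subrr.
  by rewrite seriesSr IH qprodS /u; ring.
have /cvg_ex[l ul] : cvgn (series u).
  apply: (@geometric_cvg _ _ _ nmP u (nm a * expR (nm a / (1 - nm q))) (nm q)).
    by rewrite (nm_ge0 nmP).
  move=> n; rewrite /u (nmN nmP) !(nmM nmP) (nmX nmP) mulrAC ler_wpM2r //.
    by rewrite exprn_ge0 // (nm_ge0 nmP).
  by rewrite ler_wpM2l ?(nm_ge0 nmP) // nm_qprod_le.
apply/cvg_ex; exists (l + 1).
have -> : qprod a q = (fun n => series u n + 1).
  by apply/funext => n; rewrite Su subrK.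
by apply: cvgD => //; exact: cvg_cst.
Qed.

Lemma qpoch_infS (a q : K) : nm q < 1 ->
  qpoch_inf a q = (1 - a) * qpoch_inf (a * q) q.
Proof.
move=> q1; have h := subseq_cvg (@leqnSn) (@qpoch_inf_cvg a _ q1).
apply: (cvg_uniq h); under eq_fun do rewrite qprodSl.
by apply: cvgM; [exact: cvg_cst | exact: qpoch_inf_cvg].
Qed.

Lemma qpoch_inf_dissect (a q : K) : nm q < 1 ->
  qpoch_inf a q = qpoch_inf a (q ^+ 2) * qpoch_inf (a * q) (q ^+ 2).
Proof.
move=> q1; have q21 : nm (q ^+ 2) < 1.
  by rewrite (nmX nmP) expr_lt1 // (nm_ge0 nmP).
have fn n : (n <= n.*2)%N by rewrite -addnn leq_addr.
apply: (cvg_uniq (subseq_cvg fn (@qpoch_inf_cvg a _ q1))).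
under eq_fun do rewrite qprod_dissect.
by apply: cvgM; exact: qpoch_inf_cvg.
Qed.

Lemma qpoch_inf_sqr (a q : K) : nm q < 1 ->
  qpoch_inf (a ^+ 2) (q ^+ 2) = qpoch_inf a q * qpoch_inf (- a) q.
Proof.
move=> q1; have q21 : nm (q ^+ 2) < 1.
  by rewrite (nmX nmP) expr_lt1 // (nm_ge0 nmP).
apply: (cvg_uniq (qpoch_inf_cvg q21)).
under eq_fun do rewrite -qprod_sqr.
by apply: cvgM; exact: qpoch_inf_cvg.
Qed.

(** The majorant is uniform in M, as Tannery's theorem requires. *)
Definition geo_bounded (u : nat -> nat -> K) : Prop :=
  exists c r : R, 0 <= r < 1 /\ forall M n, nm (u M n) <= c * r ^+ n.

Definition zgeo_bounded (f : nat -> int -> K) : Prop :=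
  geo_bounded (fun M n => f M (Posz n)) /\ geo_bounded (fun M n => f M (Negz n)).

Lemma bsum_tannery (f : nat -> int -> K) (g : int -> K) (l : nat -> K) :
  zgeo_bounded f -> (forall k, (fun M => f M k) @ \oo --> g k) ->
  (forall M, bilateral_sum (f M) (l M)) ->
  exists2 lg : K, bilateral_sum g lg & l @ \oo --> lg.
Proof.
case=> -[c [r [r01 h]]] [c' [r' [r01' h']]] fg fl.
have /choice[l12 H] M : exists l12 : K * K,
    [/\ series (fun n => f M (Posz n)) @ \oo --> l12.1,
        series (fun n => f M (Negz n)) @ \oo --> l12.2 & l M = l12.1 + l12.2].
  by have [a [b [ha hb hl]]] := fl M; exists (a, b).
have [|a ga la] := tannery nmP r01 h (fun n => fg (Posz n)) (l := fun M => (l12 M).1).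
  by move=> M; have [] := H M.
have [|b gb lb] := tannery nmP r01' h' (fun n => fg (Negz n)) (l := fun M => (l12 M).2).
  by move=> M; have [] := H M.
exists (a + b); first by exists a, b.
have -> : l = (fun M => (l12 M).1 + (l12 M).2) by apply/funext => M; have [] := H M.
exact: cvgD.
Qed.

Lemma bsum_uniq (f : int -> K) a b :
  bilateral_sum f a -> bilateral_sum f b -> a = b.
Proof.
move=> [a1 [a2 [h1 h2 ->]]] [b1 [b2 [h1' h2' ->]]].
by rewrite (cvg_uniq h1 h1') (cvg_uniq h2 h2').
Qed.

Lemma bsumZ (c : K) (f : int -> K) a :
  bilateral_sum f a -> bilateral_sum (fun k => c * f k) (c * a).
Proof.
move=> [a1 [a2 [h1 h2 ->]]]; exists (c * a1), (c * a2); rewrite mulrDr.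
split=> //; rewrite /series /=; under eq_fun do rewrite -mulr_sumr;
by apply: cvgM; [exact: cvg_cst|].
Qed.

Lemma bsumD (f g : int -> K) a b : bilateral_sum f a -> bilateral_sum g b ->
  bilateral_sum (fun k => f k + g k) (a + b).
Proof.
move=> [a1 [a2 [h1 h2 ->]]] [b1 [b2 [h1' h2' ->]]].
exists (a1 + b1), (a2 + b2); rewrite addrACA.
by split=> //; rewrite /series /=; under eq_fun do rewrite big_split; exact: cvgD.
Qed.

Lemma bsum0 : bilateral_sum (fun=> 0 : K) 0.
Proof.
exists 0, 0; rewrite addr0; split => //; rewrite /series /=;
by under eq_fun do rewrite big1 //; exact: cvg_cst.
Qed.

Lemma bsum_sum n (f : nat -> int -> K) (l : nat -> K) :
  (forall i, bilateral_sum (f i) (l i)) ->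
  bilateral_sum (fun k => \sum_(i < n) f i k) (\sum_(i < n) l i).
Proof.
move=> fl; elim: n => [|n IH].
  by rewrite big_ord0; under eq_fun do rewrite big_ord0; exact: bsum0.
by rewrite big_ord_recr; under eq_fun do rewrite big_ord_recr; exact: bsumD.
Qed.

(** Only the term f 0 changes sides: it leaves the half k >= 0 and becomes the first term of the
    half k < 0. *)
Lemma bsum_shift (f : int -> K) a :
  bilateral_sum f a -> bilateral_sum (fun k => f (k + 1)) a.
Proof.
move=> [a1 [a2 [h1 h2 ->]]]; exists (a1 - f 0), (a2 + f 0).
split; last by ring.
- rewrite (_ : series _ = fun n => series (fun n => f (Posz n)) n.+1 - f 0).
    by apply: cvgB; [exact: subseq_cvg h1 | exact: cvg_cst].
  apply/funext => n; rewrite /series /= [in RHS]big_nat_recl //= addrAC subrr add0r.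
  by apply: eq_bigr => i _; rewrite -addn1 PoszD.
- apply/(nm_cvgP nmP) => e e0.
  have /(nm_cvgP nmP)/(_ e e0)[N HN] := h2.
  exists N.+1 => -[//|n] Nn; have := HN n Nn; rewrite /series /= [in X in _ -> X]big_nat_recl //=.
  have -> : Negz 0 + 1 = 0 by [].
  rewrite [X in f 0 + X](eq_bigr (fun i => f (Negz i))); last by move=> i _; congr f; lia.
  by set S := bigop.body _ _ _; rewrite (_ : f 0 + S - (a2 + f 0) = S - a2) //; ring.
Qed.

(** In each half the partial sums of even length 2n split into n even and n odd indices. Convergence
    is assumed for all three series, so comparing limits suffices. *)
Lemma bsum_parity (f : int -> K) a a0 a1 : bilateral_sum f a ->
  bilateral_sum (fun k => f (2 * k)) a0 ->
  bilateral_sum (fun k => f (2 * k + 1)) a1 -> a = a0 + a1.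
Proof.
move=> [b [c [hb hc ->]]] [b0 [c0 [hb0 hc0 ->]]] [b1 [c1 [hb1 hc1 ->]]].
have fn n : (n <= n.*2)%N by rewrite -addnn leq_addr.
rewrite addrACA; congr (_ + _).
- apply: (cvg_uniq (subseq_cvg fn hb)).
  rewrite (_ : (fun n => _) = series (fun n => f (2 * Posz n)) \+
                              series (fun n => f (2 * Posz n + 1))); first exact: cvgD.
  apply/funext; elim=> [|n IH]; first by rewrite /series /= !big_geq // addr0.
  rewrite doubleS /= !seriesSr IH /= (_ : Posz n.*2 = 2 * Posz n); last by lia.
  by rewrite (_ : Posz n.*2.+1 = 2 * Posz n + 1); [ring | lia].
- apply: (cvg_uniq (subseq_cvg fn hc)).
  rewrite (_ : (fun n => _) = series (fun n => f (2 * Negz n)) \+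
                              series (fun n => f (2 * Negz n + 1))); first exact: cvgD.
  apply/funext; elim=> [|n IH]; first by rewrite /series /= !big_geq // addr0.
  (* [Negz n.*2] is -(2n + 1), so in the negative half the odd index comes first. *)
  rewrite doubleS /= !seriesSr IH /= (_ : Negz n.*2 = 2 * Negz n + 1); last by lia.
  by rewrite (_ : Negz n.*2.+1 = 2 * Negz n); [ring | lia].
Qed.

End Limits.

(** * The modulus of complex numbers *)

(** The norm on [R[i]] takes its values in [R[i]]; this is the same modulus as an element of R. *)
Definition cabs (R : realType) (x : R[i]) : R :=
  Num.sqrt (complex.Re x ^+ 2 + complex.Im x ^+ 2).

Section ComplexAbs.
Variable R : realType.
Implicit Types x y : R[i].

Lemma norm_cabs x : `|x| = (cabs x)%:C.
Proof. exact: normc_def. Qed.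

Lemma Re_le_cabs x : `|complex.Re x| <= cabs x.
Proof. by rewrite -sqrtr_sqr ler_wsqrtr // lerDl sqr_ge0. Qed.

Lemma Im_le_cabs x : `|complex.Im x| <= cabs x.
Proof. by rewrite -sqrtr_sqr ler_wsqrtr // lerDr sqr_ge0. Qed.

Lemma cabs_le x : cabs x <= `|complex.Re x| + `|complex.Im x|.
Proof.
rewrite -(@ger0_norm _ (`|_| + _)) ?addr_ge0 // -sqrtr_sqr ler_wsqrtr //.
by rewrite sqrrD !real_normK ?num_real // -addrA [_ *+ 2 + _]addrC addrA lerDl mulrn_wge0 // mulr_ge0.
Qed.

Lemma cabs_cvgP (u : nat -> (R[i] : numFieldType)) (l : (R[i] : numFieldType)) : u @ \oo --> l <->
  (forall e : R, 0 < e -> exists N, forall n, (N <= n)%N -> cabs (u n - l) < e).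
Proof.
split=> [/cvgrPdist_lt ul e e0|ul].
  have [|N _ HN] := ul e%:C; first by rewrite ltcR.
  exists N => n /HN /=; rewrite distrC => h.
  have : `|u n - l : R[i]| < e%:C by [].
  by rewrite norm_cabs ltcR.
apply/cvgrPdist_lt => e e0.
have eR : e = (complex.Re e)%:C by rewrite RRe_real // gtr0_real.
move: e0; rewrite eR ltcR => /ul[N HN].
exists N => // n /= /HN h; rewrite distrC.
suff : `|u n - l : R[i]| < (complex.Re e)%:C by [].
by rewrite norm_cabs ltcR.
Qed.

Lemma cabs_complete : @complete_abs R (R[i] : numFieldType) (@cabs R).
Proof.
split.
- by move=> x; exact: sqrtr_ge0.
- move=> x. have := normr_eq0 (x : R[i]). rewrite norm_cabs => <-.
  by rewrite -(inj_eq (@complexI R)).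
- move=> x y; apply: (@complexI R); rewrite rmorphM /= -!norm_cabs; exact: normrM.
- move=> x y; rewrite -lecR rmorphD /= -!norm_cabs; exact: ler_normD.
- exact: cabs_cvgP.
- move=> u c r /andP[r0 r1] uc.
  (* Applied to the real and to the imaginary parts, both dominated by the modulus and hence
     absolutely summable. *)
  have real_cvg (v : nat -> R) : (forall n, `|v n| <= cabs (u n)) -> cvgn (series v).
    move=> vu; apply: normed_cvg.
    apply: (@series_le_cvg _ _ (fun n => c * r ^+ n)) => //=.
    + by move=> n; apply: le_trans (uc n); exact: sqrtr_ge0.
    + by move=> n; exact: le_trans (vu n) (uc n).
    + by apply: is_cvg_geometric_series; rewrite ger0_norm.
  have /cvg_ex[a ha] := real_cvg _ (fun n => Re_le_cabs (u n)).
  have /cvg_ex[b hb] := real_cvg _ (fun n => Im_le_cabs (u n)).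
  apply/cvg_ex; exists (a +i* b); apply/cabs_cvgP => e e0.
  have e2 : 0 < e / 2 by rewrite divr_gt0.
  have /cvgrPdist_lt/(_ _ e2)[N _ HN] := ha.
  have /cvgrPdist_lt/(_ _ e2)[M _ HM] := hb.
  exists (maxn N M) => n; rewrite geq_max => /andP[/HN /= h1 /HM /= h2].
  apply: le_lt_trans (cabs_le _) _.
  have -> : complex.Re (series u n - (a +i* b)) = series (fun n => complex.Re (u n)) n - a.
    by rewrite /series /= raddfB /= raddf_sum.
  have -> : complex.Im (series u n - (a +i* b)) = series (fun n => complex.Im (u n)) n - b.
    by rewrite /series /= raddfB /= raddf_sum.
  rewrite distrC [X in _ + X]distrC; lra.
Qed.
End ComplexAbs.

(** * Gaussian binomial coefficients *)

(** The value 0 for m > n lets the range of summation over m be extended freely. *)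
Definition gbin (K : fieldType) (q : K) (n m : nat) : K :=
  if (m <= n)%N then qprod q q n / (qprod q q m * qprod q q (n - m)) else 0.

Section Gauss.
Variables (K : fieldType) (q : K).
Hypothesis qX : forall n, 1 - q * q ^+ n != 0.

Lemma qprod_neq0 n : qprod q q n != 0.
Proof. by apply/prodf_neq0 => i _; exact: qX. Qed.

Lemma gbin_small n m : (n < m)%N -> gbin q n m = 0.
Proof. by rewrite /gbin ltnNge; case: leqP. Qed.

Lemma gbin_qprod n m : (n <= m)%N -> gbin q m n = qprod q q m / (qprod q q n * qprod q q (m - n)).
Proof. by rewrite /gbin => ->. Qed.

Lemma gbin0 n : gbin q n 0 = 1.
Proof. by rewrite /gbin /= subn0 qprod0 mul1r divff // qprod_neq0. Qed.

Lemma gbinS n m :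
  gbin q n.+1 m.+1 = gbin q n m.+1 + q ^+ (n - m) * gbin q n m.
Proof.
have [nm|] := ltnP n m; first by rewrite !gbin_small ?mulr0 ?addr0 // ltnW.
rewrite leq_eqVlt => /predU1P[->|mn].
  by rewrite (gbin_small (ltnSn n)) add0r subnn expr0 mul1r /gbin !leqnn !subnn qprod0 !mulr1 !divff // qprod_neq0.
have Hn := qprod_neq0; have [d ->] : exists d, n = (m + d.+1)%N.
  by exists (n - m.+1)%N; rewrite -addSnnS subnKC.
rewrite !gbin_qprod; [|lia..].
have -> : ((m + d.+1).+1 - m.+1 = d.+1)%N by lia.
have -> : (m + d.+1 - m.+1 = d)%N by lia.
rewrite addKn addnS !qprodS.
have h1 := qX m; have h2 := qX d; have h3 := Hn m; have h4 := Hn d.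
rewrite !exprS exprD; field. by rewrite h1 h2 h3 h4.
Qed.

Lemma gauss_binomial (y : K) n :
  \prod_(j < n) (1 + y * q ^+ j) = \sum_(m < n.+1) gbin q n m * q ^+ 'C(m, 2) * y ^+ m.
Proof.
elim: n => [|n IH].
  by rewrite big_ord0 big_ord_recl big_ord0 gbin0 !expr0 !mulr1 addr0.
rewrite big_ord_recr /= IH mulrDr mulr1 [in RHS]big_ord_recl gbin0.
under [in RHS]eq_bigr => i _ do
  rewrite lift0 gbinS mulrDl mulrDl.
rewrite big_split /= addrA; congr (_ + _).
  rewrite [in RHS]big_ord_recr /= [X in _ + (_ + X)](_ : _ = 0) ?addr0; last first.
    by rewrite gbin_small // !mul0r.
  by rewrite big_ord_recl gbin0.
rewrite mulr_suml; apply: eq_bigr => i _.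
(* Here q^(n-i) is the weight in the q-Pascal rule, and q^i raises the exponent C(i,2) to
   C(i+1,2). *)
have -> : q ^+ n = q ^+ (n - i) * q ^+ i by rewrite -exprD subnK // -ltnS ltn_ord.
by rewrite binS bin1 exprD exprS; ring.
Qed.

End Gauss.

(** * A convolution of reciprocal q-factorials *)

Section RogersSzego.
Variables (K : fieldType) (p : K).
Hypothesis pX : forall n, 1 - p * p ^+ n != 0.

Let p2X n : 1 - p ^+ 2 * (p ^+ 2) ^+ n != 0.
Proof. by rewrite -exprM -exprD; have := pX (1 + 2 * n); rewrite -exprS. Qed.

Let u n := (qprod (p ^+ 2) (p ^+ 2) n)^-1.
Let e n := \sum_(a < n.+1) p ^+ a * u a * u (n - a).

Let uS n : (1 - p ^+ (2 * n.+1)) * u n.+1 = u n.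
Proof.
rewrite /u qprodS; have := p2X n; rewrite -exprM -exprD -mulnS => h.
by field; rewrite h qprod_neq0.
Qed.

Let e_rev n : e n = \sum_(a < n.+1) p ^+ (n - a) * u a * u (n - a).
Proof.
rewrite /e (reindex_inj rev_ord_inj); apply: eq_bigr => i _ /=.
rewrite subSS subKn -1?ltnS ?ltn_ord //; ring.
Qed.

(** With the first copy of e (n+1) in reversed order, the terms of index a combine to p^(n+1-a) (1 -
    p^(2a)) u_a u_(n+1-a). The term a = 0 vanishes, and for a = i + 1 the factor lowers u_(i+1) to
    u_i, leaving the reversed form of e n. *)
Let eS n : (1 - p * p ^+ n) * e n.+1 = e n.
Proof.
rewrite mulrBl mul1r {1}e_rev [in X in _ - X]/e mulr_sumr -sumrB big_ord_recl /=.
rewrite subn0 expr0 !mul1r -exprS mulrA subrr add0r e_rev.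
apply: eq_bigr => i _; rewrite ?bump0 subSS.
have -> : p ^+ n.+1 = p ^+ (n - i) * p ^+ i.+1 by rewrite -exprD addnS subnK // -ltnS ltn_ord.
by rewrite -[in RHS]uS mul2n -addnn exprD; ring.
Qed.

(* The coefficient of y^n in 1/((y;p^2)_oo (y p;p^2)_oo) = 1/(y;p)_oo. *)
Lemma sum_qprod_sqr n :
  \sum_(a < n.+1) p ^+ a / qprod (p ^+ 2) (p ^+ 2) a / qprod (p ^+ 2) (p ^+ 2) (n - a)
  = (qprod p p n)^-1.
Proof.
change (e n = (qprod p p n)^-1).
elim: n => [|n IH].
  by rewrite /e big_ord_recl big_ord0 /u !qprod0 expr0 invr1 !mulr1 addr0.
by apply: (mulfI (pX n)); rewrite eS IH qprodS; field; rewrite pX qprod_neq0.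
Qed.

End RogersSzego.

(** Regroups the double sum of [theta_weight] by n = a + b. As F vanishes outside the square, every
    diagonal may be taken in full. *)
Lemma sum_square_diag (V : zmodType) (F : nat -> nat -> V) m :
  (forall a b, (m <= a)%N || (m <= b)%N -> F a b = 0) ->
  \sum_(a < m) \sum_(b < m) F a b = \sum_(n < m.*2) \sum_(a < n.+1) F a (n - a)%N.
Proof.
move=> F0.
transitivity (\sum_(a < m.*2) \sum_(n < m.*2 | (a <= n)%N) F a (n - a)%N); last first.
  rewrite (exchange_big_dep predT) //=; apply: eq_bigr => n _.
  rewrite [in RHS](big_ord_widen _ (fun a => F a (n - a)%N) (ltn_ord n)).
  by apply: eq_bigl => a; rewrite ltnS.
rewrite (big_ord_widen m.*2 (fun a => \sum_(b < m) F a b)); last by rewrite -addnn leq_addr.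
rewrite [in RHS](bigID (fun a : 'I__ => (a < m)%N)) /= [X in _ = _ + X]big1 ?addr0; last first.
  by move=> a; rewrite -leqNgt => ma; apply: big1 => n _; rewrite F0 ?ma.
apply: eq_bigr => a am.
transitivity (\sum_(0 <= b < m.*2 - a) F a b).
  rewrite -(big_mkord predT (F a)) (@big_cat_nat _ _ _ m 0 (m.*2 - a)) //=; last by lia.
  rewrite [X in _ = _ + X]big1_seq ?addr0 // => b /andP[_]; rewrite mem_index_iota => /andP[mb _].
  by rewrite F0 // mb orbT.
rewrite -(big_mkord (fun n => (a <= n)%N) (fun n => F a (n - a)%N)).
rewrite [in RHS](@big_cat_nat _ _ _ a) //=; last by lia.
rewrite [X in _ = X + _]big_nat_cond [X in _ = X + _]big1 ?add0r; last by move=> n; lia.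
rewrite (_ : bigop.body _ (index_iota a _) _ =
    \sum_(0 + a <= n < m.*2 | (a <= n)%N) F a (n - a)%N) //.
rewrite big_addn big_nat_cond [in RHS]big_nat_cond.
by apply: eq_big => [n|n _]; [lia | rewrite addnK].
Qed.

(** In base q = s^2 this turns q^C(n,2) s^n into s^(n^2). *)
Lemma bin2_sqr n : (2 * 'C(n, 2) + n = n * n)%N.
Proof. by elim: n => // n IH; rewrite binS bin1; lia. Qed.

(** The quotient of consecutive terms is X r^(2n+1), at most X r^n. *)
Lemma gauss_decay (R : realType) (r X : R) : 0 < r < 1 -> 0 <= X ->
  exists c, forall n, r ^+ (n * n) * X ^+ n <= c * r ^+ n.
Proof.
move=> r01 X0; have /andP[r0 r1] := r01.
apply: (ratio_geometric (L := X) r01) => n.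
  by rewrite mulr_ge0 // exprn_ge0 // ltW.
have -> : (n.+1 * n.+1 = n * n + n + n.+1)%N by lia.
rewrite !exprD [X ^+ n.+1]exprS.
have -> : r ^+ (n * n) * r ^+ n * r ^+ n.+1 * (X * X ^+ n) = X * r ^+ n * (r ^+ (n * n) * X ^+ n) * r ^+ n.+1 by ring.
apply: ler_piMr; last by rewrite exprn_ile1 // ltW.
by rewrite !mulr_ge0 // exprn_ge0 // ltW.
Qed.

(** * Limits of Gaussian binomials, Euler's identity and the weights c(s) *)

Section Series.
Variables (R : realType) (K : numFieldType) (nm : K -> R).
Hypothesis nmP : complete_abs nm.

Lemma series_finite_cvg (u : nat -> K) N :
  (forall n, (N <= n)%N -> u n = 0) -> series u @ \oo --> \sum_(n < N) u n.
Proof.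
move=> u0; apply/(nm_cvgP nmP) => e e0; exists N => n Nn.
rewrite /series /= (@big_cat_nat _ _ _ N 0 n) //= big_mkord.
rewrite [X in _ + X - _]big1_seq ?addr0 ?subrr ?(nm0 nmP) // => i /andP[_].
by rewrite mem_index_iota => /andP[Ni _]; rewrite u0.
Qed.

Section Base.
Variable q : K.
Hypothesis q1 : nm q < 1.

Lemma sub1X_neq0 n : 1 - q * q ^+ n != 0.
Proof.
rewrite subr_eq0 -exprS; apply/eqP => h.
have := nm1 nmP; rewrite h (nmX nmP) => /eqP.
by rewrite lt_eqF // exprn_ilt1 // (nm_ge0 nmP).
Qed.

(** With r = |q| and t = r^j, each inverse factor is at most 1/(1 - rt) <= 1 + rt/(1 - r); the
    second inequality uses t <= 1. So the estimate for products of 1 + c r^j also bounds the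
    inverses. *)
Lemma nm_qprodV_le n :
  nm (qprod q q n)^-1 <= expR (nm q / (1 - nm q) / (1 - nm q)).
Proof.
have r0 := nm_ge0 nmP q; have r1' : 0 < 1 - nm q by rewrite subr_gt0.
apply: le_trans; last first.
  by apply: (@prod1D_geometric_le _ (nm q / (1 - nm q)) (nm q) n); rewrite ?divr_ge0 ?r0 // ltW.
rewrite (nmV nmP) /qprod (nm_prod nmP) -prodfV; apply: ler_prod => j _.
rewrite invr_ge0 (nm_ge0 nmP) /=.
set t := nm q ^+ j.
have t0 : 0 <= t by rewrite exprn_ge0.
have t1 : t <= 1 by rewrite exprn_ile1 // ltW.
have qt : nm q * t < 1 by apply: le_lt_trans q1; rewrite ler_piMr.
have h : 1 - nm q * t <= nm (1 - q * q ^+ j).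
  have := ler_nmD nmP (1 - q * q ^+ j) (q * q ^+ j).
  by rewrite subrK (nm1 nmP) (nmM nmP) (nmX nmP) -/t lerBlDr.
have qt' : 0 < 1 - nm q * t by rewrite subr_gt0.
apply: (@le_trans _ _ (1 - nm q * t)^-1).
  by rewrite lef_pV2 // posrE // (lt_le_trans qt').
rewrite -[X in X <= _]mul1r ler_pdivrMr //.
rewrite [X in _ <= X](_ : _ = 1 + nm q * t * (nm q * (1 - t)) / (1 - nm q)); last first.
  by field; rewrite gt_eqF.
by rewrite lerDl divr_ge0 // ?mulr_ge0 // ?subr_ge0 // ltW.
Qed.

(** The inverses of the partial products are bounded by B, so the partial products stay at distance
    at least 1/B from 0. *)
Lemma qpoch_inf_neq0 : qpoch_inf q q != 0.
Proof.
apply/negP => /eqP L0; have := @qpoch_inf_cvg _ _ _ nmP q q q1; rewrite L0.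
pose B := expR (nm q / (1 - nm q) / (1 - nm q)).
move/(nm_cvgP nmP)/(_ B^-1) => []; first by rewrite invr_gt0 expR_gt0.
move=> N /(_ N (leqnn N)); rewrite subr0; apply/negP; rewrite -leNgt.
have := nm_qprodV_le N; rewrite (nmV nmP) -/B => h.
have n0 : 0 < nm (qprod q q N) by apply: (nm_gt0 nmP); apply: qprod_neq0 sub1X_neq0 _.
by rewrite -[leRHS]invrK lef_pV2 // posrE ?invr_gt0 // expR_gt0.
Qed.

Lemma nm_gbin_le : exists2 B : R, 0 <= B & forall n m, nm (gbin q n m) <= B.
Proof.
pose B1 := expR (nm q / (1 - nm q)); pose B2 := expR (nm q / (1 - nm q) / (1 - nm q)).
have B10 : 0 <= B1 by exact: expR_ge0.
have B20 : 0 <= B2 by exact: expR_ge0.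
exists (B1 * (B2 * B2)); first by rewrite !mulr_ge0.
move=> n m; rewrite /gbin; case: ifP => _; last by rewrite (nm0 nmP) !mulr_ge0.
rewrite invfM !(nmM nmP).
by rewrite !ler_pM ?mulr_ge0 ?(nm_ge0 nmP) ?nm_qprodV_le // nm_qprod_le.
Qed.

Lemma shift_cvg (u : nat -> K) (l : K) m :
  (fun n => u (n + m)%N) @ \oo --> l -> u @ \oo --> l.
Proof.
move=> /(nm_cvgP nmP) h; apply/(nm_cvgP nmP) => e /h[N HN].
exists (N + m)%N => n Nn; have := HN (n - m)%N; rewrite subnK; last by lia.
by apply; lia.
Qed.

Lemma gbin_cvg m : (fun n => gbin q n m) @ \oo --> (qprod q q m)^-1.
Proof.
have L0 := qpoch_inf_neq0; have Lc := @qpoch_inf_cvg _ _ _ nmP q q q1.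
apply: (@shift_cvg _ _ m); under eq_fun do rewrite gbin_qprod ?leq_addl // addnK.
rewrite (_ : (qprod q q m)^-1 = qpoch_inf q q / (qprod q q m * qpoch_inf q q)).
  apply: cvgM; first by apply: (subseq_cvg nmP) Lc => n; exact: leq_addr.
  apply: cvgV; first by rewrite mulf_neq0 // qprod_neq0 // => n; exact: sub1X_neq0.
  by apply: cvgM => //; exact: cvg_cst.
by field; rewrite L0 qprod_neq0 // => n; exact: sub1X_neq0.
Qed.

Lemma gbin_central_cvg m :
  (fun n => gbin q n.*2 (n + m)) @ \oo --> (qpoch_inf q q)^-1.
Proof.
have L0 := qpoch_inf_neq0; have Lc := @qpoch_inf_cvg _ _ _ nmP q q q1.
(* After replacing n by n + m, the lower index n + 2m never exceeds the upper index 2n + 2m, so the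
   coefficient is the quotient of products for every n. *)
apply: (@shift_cvg _ _ m).
rewrite (_ : (fun n => _) = fun n => qprod q q (n + m).*2 / (qprod q q (n + m + m) * qprod q q n)).
  rewrite (_ : (qpoch_inf q q)^-1 = qpoch_inf q q / (qpoch_inf q q * qpoch_inf q q)).
    apply: cvgM; first by apply: (subseq_cvg nmP (f := fun n => (n + m).*2)) Lc => n; lia.
    apply: cvgV; first by rewrite mulf_neq0.
    by apply: cvgM => //; apply: (subseq_cvg nmP (f := fun n => (n + m + m)%N)) Lc => n; lia.
  by field.
apply/funext => n; rewrite gbin_qprod; last by lia.
by have -> : ((n + m).*2 - (n + m + m) = n)%N by lia.
Qed.

End Base.

Lemma nm_sqr_lt1 (s : K) : nm s < 1 -> nm (s ^+ 2) < 1.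
Proof. by move=> s1; rewrite (nmX nmP) exprn_ilt1 // (nm_ge0 nmP). Qed.

(** The Gauss binomial theorem in base s^2 at y = s, with the number M of factors tending to
    infinity termwise. *)
Lemma euler_cvg (s : K) : s != 0 -> nm s < 1 ->
  series (fun n => s ^+ (n * n) / qprod (s ^+ 2) (s ^+ 2) n) @ \oo
    --> qpoch_inf (- s) (s ^+ 2).
Proof.
move=> s0 s1; have q1 := nm_sqr_lt1 s1.
have [B B0 HB] := nm_gbin_le q1.
have r01 : 0 < nm s < 1 by rewrite (nm_gt0 nmP).
have [c Hc] := gauss_decay r01 (@ler01 R).
pose u M n := gbin (s ^+ 2) M n * s ^+ (n * n).
have ub M n : nm (u M n) <= B * c * nm s ^+ n.
  rewrite /u (nmM nmP) (nmX nmP) -mulrA ler_pM ?(nm_ge0 nmP) ?exprn_ge0 ?(nm_ge0 nmP) //.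
  by have := Hc n; rewrite expr1n mulr1.
have r01' : 0 <= nm s < 1 by case/andP: r01 => /ltW -> ->.
have uv n : (fun M => u M n) @ \oo --> s ^+ (n * n) / qprod (s ^+ 2) (s ^+ 2) n.
  by rewrite mulrC; apply: cvgM; [exact: gbin_cvg | exact: cvg_cst].
have ul M : series (u M) @ \oo --> qprod (- s) (s ^+ 2) M.
  have -> : qprod (- s) (s ^+ 2) M = \sum_(n < M.+1) u M n.
    rewrite /qprod; under eq_bigr do rewrite mulNr opprK.
    rewrite gauss_binomial; last by move=> n; exact: sub1X_neq0.
    by apply: eq_bigr => n _; rewrite /u -mulrA -exprM -exprD bin2_sqr.
  by apply: series_finite_cvg => n Mn; rewrite /u gbin_small // mul0r.
have [l vl ql] := tannery nmP r01' ub uv ul.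
by have <- := cvg_uniq ql (@qpoch_inf_cvg _ _ _ nmP _ _ q1).
Qed.

(* The M-th truncation of c(s). *)
Definition theta_weight (s : K) (M : nat) : K :=
  \sum_(a < M.+1) \sum_(b < M.+1)
    gbin (s ^+ 4) M a * gbin (s ^+ 4) M b * s ^+ ((a + b) * (a + b) + 2 * a).

(** The diagonal a + b = n contributes s^(n^2) times a convolution that tends to 1/(s^2;s^2)_n by
    [sum_qprod_sqr] with p = s^2. Euler's identity then sums over n. *)
Lemma theta_weight_cvg (s : K) : s != 0 -> nm s < 1 ->
  theta_weight s @ \oo --> qpoch_inf (- s) (s ^+ 2).
Proof.
move=> s0 s1; have q1 := nm_sqr_lt1 s1; have := nm_sqr_lt1 q1.
rewrite -exprM => q41; have [B B0 HB] := nm_gbin_le q41.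
have s_ge0 := nm_ge0 nmP s.
have r01 : 0 < nm s < 1 by rewrite (nm_gt0 nmP).
(* A diagonal has n + 1 terms, whence the extra factor n + 1 in the majorant; n + 2 <= 2 (n + 1)
   gives L = 2. *)
have [c Hc] : exists c, forall n, nm s ^+ (n * n) * n.+1%:R <= c * nm s ^+ n.
  apply: (ratio_geometric (L := 2) r01) => n; first by rewrite mulr_ge0 ?exprn_ge0.
  have -> : (n.+1 * n.+1 = n * n + n + n.+1)%N by lia.
  rewrite !exprD.
  rewrite [leRHS](_ : _ = nm s ^+ (n * n) * nm s ^+ n * 1 * (2 * n.+1%:R)); last by ring.
  rewrite ler_pM ?mulr_ge0 ?exprn_ge0 //.
    by rewrite ler_pM ?mulr_ge0 ?exprn_ge0 // exprn_ile1 // ltW.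
  by rewrite -natrM ler_nat; lia.
pose F M a b : K := gbin (s ^+ 4) M a * gbin (s ^+ 4) M b * s ^+ ((a + b) * (a + b) + 2 * a).
pose u M n := \sum_(a < n.+1) F M a (n - a)%N.
have uE M n : u M n = s ^+ (n * n) * \sum_(a < n.+1) gbin (s ^+ 4) M a * gbin (s ^+ 4) M (n - a) * s ^+ (2 * a).
  rewrite /u mulr_sumr; apply: eq_bigr => a _; rewrite /F subnKC ?exprD -1?ltnS ?ltn_ord //.
  by ring.
have ub M n : nm (u M n) <= B * B * c * nm s ^+ n.
  rewrite uE (nmM nmP) (nmX nmP).
  apply: (@le_trans _ _ (nm s ^+ (n * n) * (B * B * n.+1%:R))).
    rewrite ler_wpM2l ?exprn_ge0 //; apply: le_trans (ler_nm_sum nmP _ _ _) _.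
    apply: (@le_trans _ _ (\sum_(a < n.+1) B * B)).
      apply: ler_sum => a _; rewrite !(nmM nmP) (nmX nmP).
      rewrite -[leRHS]mulr1 ler_pM ?mulr_ge0 ?(nm_ge0 nmP) ?exprn_ge0 ?exprn_ile1 ?(ltW s1) //.
      by rewrite ler_pM ?(nm_ge0 nmP).
    by rewrite sumr_const card_ord mulr_natr.
  by rewrite mulrCA -mulrA ler_wpM2l ?mulr_ge0.
have r01' : 0 <= nm s < 1 by case/andP: r01 => /ltW -> ->.
have uv n : (fun M => u M n) @ \oo --> s ^+ (n * n) / qprod (s ^+ 2) (s ^+ 2) n.
  under eq_fun do rewrite uE.
  apply: cvgM; first exact: cvg_cst.
  rewrite -(@sum_qprod_sqr _ (s ^+ 2)); last by move=> m; exact: sub1X_neq0.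
  have cs (I : eqType) (r : seq I) (G : I -> nat -> K) (g : I -> K) :
      (forall i, G i @ \oo --> g i) -> (fun M => \sum_(i <- r) G i M) @ \oo --> \sum_(i <- r) g i.
    move=> Gg; elim: r => [|i r IH].
      by under eq_fun do rewrite big_nil; rewrite big_nil; exact: cvg_cst.
    by under eq_fun do rewrite big_cons; rewrite big_cons; exact: cvgD.
  apply: cs => a; rewrite -!exprM.
  rewrite [X in _ --> X](_ : _ = (qprod (s ^+ 4) (s ^+ 4) a)^-1 * (qprod (s ^+ 4) (s ^+ 4) (n - a))^-1 * s ^+ (2 * a)); last by ring.
  by apply: cvgM; [apply: cvgM; exact: gbin_cvg | exact: cvg_cst].
have ul M : series (u M) @ \oo --> theta_weight s M.
  have F0 a b : (M.+1 <= a)%N || (M.+1 <= b)%N -> F M a b = 0.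
    by case/orP => h; rewrite /F (gbin_small _ h) !(mul0r, mulr0).
  have -> : theta_weight s M = \sum_(n < M.+1.*2) u M n.
    by rewrite /theta_weight -sum_square_diag.
  apply: series_finite_cvg => n Mn; rewrite /u big1 // => a _.
  by rewrite F0 //; have := ltn_ord a; lia.
have [l vl tl] := tannery nmP r01' ub uv ul.
by rewrite -(cvg_uniq vl (euler_cvg s0 s1)).
Qed.

End Series.

(** * The Jacobi triple product *)

Section JacobiFinite.
Variables (K : fieldType) (s x : K).
Hypotheses (s0 : s != 0) (x0 : x != 0).

(** Read backwards, the factors are 1 + x s^(-2j-1) = (x / s^(2j+1)) (1 + s^(2j+1) / x), and the
    first M odd numbers add up to M^2. *)
Lemma qprod_reverse M :
  qprod (- (x * s / s ^+ (2 * M))) (s ^+ 2) M =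
  x ^+ M / s ^+ (M * M) * qprod (- (s / x)) (s ^+ 2) M.
Proof.
have sX n : s ^+ n != 0 by rewrite expf_neq0.
rewrite /qprod (reindex_inj rev_ord_inj) /=.
have -> : x ^+ M / s ^+ (M * M) = \prod_(j < M) (x / s ^+ (2 * j + 1)).
  elim: M => [|M IH]; first by rewrite big_ord0 mul0n !expr0 divr1.
  rewrite big_ord_recr /= -IH (_ : (M.+1 * M.+1 = M * M + (2 * M + 1))%N); last by lia.
  by rewrite exprD exprS; field; rewrite !sX.
rewrite -big_split; apply: eq_bigr => j _ /=.
have -> : s ^+ (2 * M) = (s ^+ 2) ^+ (M - j.+1) * s ^+ (2 * j + 2).
  by rewrite -exprM -exprD; congr (_ ^+ _); have := ltn_ord j; lia.
have -> : s ^+ (2 * j + 2) = s ^+ (2 * j) * s ^+ 2 by rewrite exprD.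
have -> : s ^+ (2 * j + 1) = s ^+ (2 * j) * s by rewrite exprD expr1.
by rewrite -!exprM; field; rewrite x0 s0 !sX.
Qed.

Hypothesis sX : forall n, 1 - s ^+ 2 * (s ^+ 2) ^+ n != 0.

Lemma gbin_sym n m : (m <= n)%N -> gbin (s ^+ 2) n (n - m) = gbin (s ^+ 2) n m.
Proof.
by move=> mn; rewrite !gbin_qprod ?leq_subr // subKn // [X in _ / X]mulrC.
Qed.

Lemma jacobi_finite M :
  qprod (- (x * s)) (s ^+ 2) M * qprod (- (s / x)) (s ^+ 2) M =
  \sum_(i < (M + M.+1)) gbin (s ^+ 2) M.*2 i *
     (s ^ ((Posz i - Posz M) ^+ 2) * x ^ (Posz i - Posz M)).
Proof.
have sX' n : s ^+ n != 0 by rewrite expf_neq0.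
have xX' n : x ^+ n != 0 by rewrite expf_neq0.
(* With this y, the 2M factors of the Gauss binomial theorem are 1 + x s^m for the odd m from 1 - 2M
   to 2M - 1. *)
pose y := x * s / s ^+ (2 * M).
have : qprod (- y) (s ^+ 2) M.*2 = \sum_(i < M.*2.+1) gbin (s ^+ 2) M.*2 i * (s ^+ 2) ^+ 'C(i, 2) * y ^+ i.
  by rewrite -gauss_binomial // /qprod; apply: eq_bigr => j _; rewrite mulNr opprK.
rewrite -addnn qprodD /y qprod_reverse -exprM mulNr divfK // => H.
apply: (mulfI (x := x ^+ M / s ^+ (M * M))); first by rewrite mulf_neq0 ?invr_eq0.
rewrite mulrA mulrAC {}H addnS mulr_sumr; apply: eq_bigr => i _.
have -> : s ^ ((Posz i - Posz M) ^+ 2) = s ^+ (i * i) * s ^+ (M * M) / s ^+ (2 * M * i).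
  rewrite [in RHS](exprnP s) [X in _ * X / _]exprnP [X in _ / X]exprnP invr_expz -!expfzDr //; congr (_ ^ _); rewrite expr2; lia.
have -> : x ^ (Posz i - Posz M) = x ^+ i / x ^+ M.
  by rewrite !exprnP invr_expz -!expfzDr.
rewrite -(bin2_sqr i) exprD expr_div_n [(x * s) ^+ i]exprMn -!exprM.
by field; rewrite !xX' !sX'.
Qed.

End JacobiFinite.

Section Jacobi.
Variables (R : realType) (K : numFieldType) (nm : K -> R).
Hypothesis nmP : complete_abs nm.

Lemma theta_geo_bounded (w : nat -> int -> K) (s x : K) (B : R) :
  s != 0 -> nm s < 1 -> x != 0 -> (forall M k, nm (w M k) <= B) ->
  zgeo_bounded nm (fun M k => w M k * (s ^ (k ^+ 2) * x ^ k)).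
Proof.
move=> s0 s1 x0 wB.
have r01 : 0 < nm s < 1 by rewrite (nm_gt0 nmP).
have r01' : 0 <= nm s < 1 by case/andP: r01 => /ltW -> ->.
have s_ge0 := nm_ge0 nmP s; have x_ge0 := nm_ge0 nmP x.
split.
  have [c Hc] := gauss_decay r01 x_ge0.
  exists (B * c), (nm s); split=> // M n.
  rewrite !(nmM nmP) !(nmXz nmP) -!exprnP -mulrA ler_pM ?mulr_ge0 ?exprn_ge0 ?(nm_ge0 nmP) //.
have xV_ge0 : 0 <= (nm x)^-1 by rewrite invr_ge0.
have [c Hc] := gauss_decay r01 xV_ge0.
(* [Negz n] stands for -(n + 1); the extra factor [nm s] moves the bound to index n + 1. *)
exists (B * (c * nm s)), (nm s); split=> // M n.
rewrite !(nmM nmP) !(nmXz nmP) -!mulrA ler_pM ?mulr_ge0 ?exprz_ge0 ?(nm_ge0 nmP) //.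
rewrite -exprS; apply: le_trans (Hc n.+1).
have -> : nm s ^ (Negz n ^+ 2) = nm s ^+ (n.+1 * n.+1).
  by rewrite (_ : Negz n ^+ 2 = Posz (n.+1 * n.+1)) // expr2; lia.
by rewrite exprVn.
Qed.

(** The limit of [jacobi_finite]: the coefficients near the centre tend to 1/(s^2;s^2)_oo, and
    Tannery's theorem applies because they are uniformly bounded. *)
Lemma jacobi_triple (s x : K) : s != 0 -> nm s < 1 -> x != 0 ->
  bilateral_sum (fun k => s ^ (k ^+ 2) * x ^ k)
    (qpoch_inf (s ^+ 2) (s ^+ 2) *
     (qpoch_inf (- (x * s)) (s ^+ 2) * qpoch_inf (- (s / x)) (s ^+ 2))).
Proof.
move=> s0 s1 x0; have q1 := nm_sqr_lt1 nmP s1.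
have qX := sub1X_neq0 nmP q1; have L0 := qpoch_inf_neq0 nmP q1.
have [B B0 HB] := nm_gbin_le nmP q1.
(* By the symmetry of the Gaussian binomial the coefficient depends only on |k|, so one limit serves
   both halves. *)
pose w M (k : int) := gbin (s ^+ 2) M.*2 (M + `|k|).
have bd := theta_geo_bounded s0 s1 x0 (fun M k => HB M.*2 (M + `|k|)%N : nm (w M k) <= B).
pose l M := qprod (- (x * s)) (s ^+ 2) M * qprod (- (s / x)) (s ^+ 2) M.
have fl M : bilateral_sum (fun k => w M k * (s ^ (k ^+ 2) * x ^ k)) (l M).
  exists (\sum_(n < M.+1) w M (Posz n) * (s ^ (Posz n ^+ 2) * x ^ Posz n)).
  exists (\sum_(n < M) w M (Negz n) * (s ^ (Negz n ^+ 2) * x ^ Negz n)).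
  split.
  - by apply: (series_finite_cvg nmP) => n Mn; rewrite /w gbin_small ?mul0r // absz_nat; lia.
  - by apply: (series_finite_cvg nmP) => n Mn; rewrite /w gbin_small ?mul0r //; lia.
  - rewrite /l jacobi_finite // big_split_ord /= addrC; congr (_ + _).
      by apply: eq_bigr => n _; rewrite /w absz_nat PoszD addrAC subrr add0r.
    rewrite (reindex_inj rev_ord_inj) /=; apply: eq_bigr => n _.
    have nM := ltn_ord n.
    have -> : Posz (M - n.+1) - Posz M = Negz n by lia.
    congr (_ * _); rewrite /w -gbin_sym; last by lia.
    by congr gbin; lia.
have [] := bsum_tannery nmP (g := fun k => (qpoch_inf (s ^+ 2) (s ^+ 2))^-1 * (s ^ (k ^+ 2) * x ^ k)) bd _ fl.
  move=> k; apply: cvgM; last exact: cvg_cst.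
  exact: (gbin_central_cvg nmP q1).
move=> lg gs lgs.
have -> : qpoch_inf (- (x * s)) (s ^+ 2) * qpoch_inf (- (s / x)) (s ^+ 2) = lg.
  by apply: (cvg_uniq _ lgs); apply: cvgM; exact: (qpoch_inf_cvg nmP q1).
have := bsumZ (qpoch_inf (s ^+ 2) (s ^+ 2)) gs.
by under eq_fun do rewrite mulVKf //.
Qed.

End Jacobi.

(** * Majorants for products with shifted argument *)

Section RealBounds.
Variable R : realType.

(** Factors with a negative power of t are kept as an explicit product. In the induction on k one
    factor is appended at the end; the first, 1 + c / t^(k+1), is then split off, and the others are
    those for k. *)
Lemma prod1D_shift_le (c t : R) (k M : nat) : 0 <= c -> 0 < t < 1 ->
  \prod_(j < M) (1 + c / t ^+ k * t ^+ j) <=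
  expR (c / (1 - t)) * \prod_(i < k) (1 + c / t ^+ i.+1).
Proof.
move=> c0 t01; have /andP[t0 t1] := t01; elim: k => [|k IH].
  rewrite big_ord0 mulr1 expr0 divr1; apply: prod1D_geometric_le => //.
  by rewrite ltW.
have h n m : 0 <= c / t ^+ n * t ^+ m by rewrite mulr_ge0 ?divr_ge0 ?exprn_ge0 // ltW.
have h' n : 0 <= c / t ^+ n by have := h n 0%N; rewrite expr0 mulr1.
apply: (@le_trans _ _ (\prod_(j < M.+1) (1 + c / t ^+ k.+1 * t ^+ j))).
  rewrite [leRHS]big_ord_recr /= ler_peMr ?lerDl //.
  by apply: prodr_ge0 => j _; rewrite addr_ge0.
rewrite big_ord_recl expr0 mulr1 [in leRHS]big_ord_recr /= mulrA mulrC.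
apply: ler_wpM2r; first by rewrite addr_ge0.
rewrite (eq_bigr (fun j : 'I_M => 1 + c / t ^+ k * t ^+ j)) // => j _.
by rewrite /bump leq0n add1n !exprS; field; rewrite (gt_eqF t0) expf_neq0 // gt_eqF.
Qed.

(** The exponent grows by at least 4n, while the new factor costs only about r^(-2n-2). The quotient
    of consecutive terms is thus at most A r^(4n) + (A c / r^2) r^(2n), hence at most L r^n. *)
Lemma gauss_prod_decay (r A c : R) (E : nat -> nat) :
  0 < r < 1 -> 0 <= A -> 0 <= c -> (forall n, E n + 4 * n <= E n.+1)%N ->
  exists C, forall n,
    r ^+ E n * A ^+ n * \prod_(i < n) (1 + c / (r ^+ 2) ^+ i.+1) <= C * r ^+ n.
Proof.
move=> r01 A0 c0 HE; have /andP[r0 r1] := r01.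
have P0 n : 0 <= \prod_(i < n) (1 + c / (r ^+ 2) ^+ i.+1).
  by apply: prodr_ge0 => i _; rewrite addr_ge0 // divr_ge0 ?exprn_ge0 // ltW.
apply: (ratio_geometric (L := A + A * c / r ^+ 2) r01) => n.
  by rewrite !mulr_ge0 // exprn_ge0 // ltW.
rewrite big_ord_recr /= (exprS A).
set P := \prod_(i < n) _.
apply: (@le_trans _ _ (r ^+ (E n + 4 * n) * (A * A ^+ n) * (P * (1 + c / (r ^+ 2) ^+ n.+1)))).
  rewrite ler_wpM2r ?mulr_ge0 ?addr_ge0 ?divr_ge0 ?exprn_ge0 ?(ltW r0) ?P0 //.
  by rewrite ler_wpM2r ?mulr_ge0 ?exprn_ge0 // ler_wiXn2l ?(ltW r0) ?(ltW r1).
have -> : r ^+ (E n + 4 * n) * (A * A ^+ n) * (P * (1 + c / (r ^+ 2) ^+ n.+1)) =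
  (A * r ^+ n ^+ 3 + A * c / r ^+ 2 * r ^+ n) * r ^+ n * (r ^+ E n * A ^+ n * P).
  rewrite exprS exprD exprAC -[(4 * n)%N]mulnC exprM; field.
  by rewrite expf_neq0 ?(gt_eqF r0).
rewrite ler_wpM2r ?mulr_ge0 ?exprn_ge0 ?(ltW r0) ?P0 //.
rewrite ler_wpM2r ?exprn_ge0 ?(ltW r0) //.
have rn1 : r ^+ n <= 1 by rewrite exprn_ile1 // ltW.
have rn0 : 0 <= r ^+ n by rewrite exprn_ge0 // ltW.
rewrite lerD // ler_piMr ?mulr_ge0 ?invr_ge0 ?exprn_ge0 ?(ltW r0) //.
by rewrite exprn_ile1.
Qed.

End RealBounds.

(** The truncation of h(y) = (-y p^2, -p/y; p^2)_oo. *)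
Definition jprod (K : fieldType) (p y : K) (M : nat) : K :=
  qprod (- (y * p ^+ 2)) (p ^+ 2) M * qprod (- (p / y)) (p ^+ 2) M.

Lemma jprodE (K : fieldType) (p y : K) M : p != 0 -> y != 0 ->
  (forall n, 1 - p ^+ 2 * (p ^+ 2) ^+ n != 0) ->
  jprod p y M = \sum_(a < M.+1) \sum_(b < M.+1)
    gbin (p ^+ 2) M a * gbin (p ^+ 2) M b *
    (p ^ Posz (a * a + a + b * b) * y ^ (Posz a - Posz b)).
Proof.
move=> p0 y0 pX.
have E z : qprod (- z) (p ^+ 2) M =
    \sum_(a < M.+1) gbin (p ^+ 2) M a * (p ^+ 2) ^+ 'C(a, 2) * z ^+ a.
  by rewrite -gauss_binomial // /qprod; apply: eq_bigr => j _; rewrite mulNr opprK.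
rewrite /jprod !E big_distrlr /=; apply: eq_bigr => a _; apply: eq_bigr => b _.
rewrite expfzDr // -!exprnP -exprnN -(bin2_sqr a) -(bin2_sqr b).
rewrite !exprD expr_div_n [(y * _) ^+ a]exprMn -!exprM !mul2n -!addnn !exprD.
by field; rewrite expf_neq0.
Qed.

Lemma expN1_even (K : fieldType) (m : int) : (-1) ^ (2 * m) = 1 :> K.
Proof. by rewrite -exprz_exp -exprnP sqrrN expr1n exp1rz. Qed.

Lemma expN1_sqr (K : fieldType) (k : int) : (-1) ^ (k ^+ 2) = (-1) ^ k :> K.
Proof.
have N0 : -1 != 0 :> K by rewrite oppr_eq0 oner_eq0.
have [m [->|->]] : exists m : int, k = 2 * m \/ k = 2 * m + 1.
  by exists (k %/ 2)%Z; lia.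
  by rewrite (_ : (2 * m) ^+ 2 = 2 * (2 * m ^+ 2)) ?expN1_even //; ring.
rewrite (_ : (2 * m + 1) ^+ 2 = 2 * (2 * m ^+ 2 + 2 * m) + 1); last by ring.
by rewrite !expfzDr // !expN1_even.
Qed.

(** * Theta series along arithmetic progressions *)

Section Bilateral.
Variables (R : realType) (K : numFieldType) (nm : K -> R).
Hypothesis nmP : complete_abs nm.

Lemma bsum_unshift (f : int -> K) a :
  bilateral_sum f a -> bilateral_sum (fun k => f (k - 1)) a.
Proof.
move=> [a1 [a2 [h1 h2 ->]]]; exists (a1 + f (-1)), (a2 - f (-1)).
split; last by ring.
- apply/(nm_cvgP nmP) => e e0.
  have /(nm_cvgP nmP)/(_ e e0)[N HN] := h1.
  exists N.+1 => -[//|n] Nn; have := HN n Nn.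
  rewrite /series /= [in X in _ -> X]big_nat_recl //=.
  rewrite [X in f _ + X](eq_bigr (fun i => f (Posz i))); last by move=> i _; congr f; lia.
  set S := bigop.body _ _ _; rewrite sub0r.
  by rewrite (_ : f (-1) + S - (a1 + f (-1)) = S - a1) //; ring.
- rewrite (_ : series _ = fun n => series (fun n => f (Negz n)) n.+1 - f (-1)).
    by apply: cvgB; [exact: (subseq_cvg nmP) h2 | exact: cvg_cst].
  apply/funext => n; rewrite /series /= [in RHS]big_nat_recl //= addrAC subrr add0r.
  by apply: eq_bigr => i _; congr f; lia.
Qed.

Lemma bsum_ext (f g : int -> K) a b :
  bilateral_sum f a -> f =1 g -> a = b -> bilateral_sum g b.
Proof. by move=> fa /funext <- <-. Qed.

Lemma bsum_shiftz (f : int -> K) a (d : int) :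
  bilateral_sum f a -> bilateral_sum (fun k => f (k + d)) a.
Proof.
move=> fa; elim/int_ind: d => [|n IH|n IH].
- by under eq_fun do rewrite addr0.
- by apply: bsum_ext (bsum_shift nmP IH) _ _ => // k; congr f; lia.
- by apply: bsum_ext (bsum_unshift IH) _ _ => // k; congr f; lia.
Qed.

(** The sum over k of s^(k^2) x^k, written as the product supplied by [jacobi_triple]. *)
Definition theta (s x : K) : K :=
  qpoch_inf (s ^+ 2) (s ^+ 2) *
    (qpoch_inf (- (x * s)) (s ^+ 2) * qpoch_inf (- (s / x)) (s ^+ 2)).

(** As (-1)^(k^2) = (-1)^k, replacing s by -s changes the sign of the odd terms, so a half sum or
    half difference selects the indices congruent to d modulo 2. *)
Lemma theta_progression (s x : K) (d : int) : s != 0 -> nm s < 1 -> x != 0 ->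
  bilateral_sum (fun k => s ^ ((2 * k + d) ^+ 2) * x ^ (2 * k + d))
    (2^-1 * (theta s x + (-1) ^ d * theta (- s) x)).
Proof.
move=> s0 s1 x0.
have Ns0 : - s != 0 by rewrite oppr_eq0.
have Ns1 : nm (- s) < 1 by rewrite (nmN nmP).
pose g (k : int) := s ^ (k ^+ 2) * x ^ k.
have Nsg k : (- s) ^ (k ^+ 2) * x ^ k = (-1) ^ k * g k.
  by rewrite /g -[- s]mulN1r expfzMl -mulrA expN1_sqr.
have H1 := bsum_shiftz d (jacobi_triple nmP s0 s1 x0).
have H2 := bsum_shiftz d (jacobi_triple nmP Ns0 Ns1 x0).
(* Convergence of the subseries: expanding (2k + d')^2 exhibits it as a multiple of a theta series
   in s^4. *)
have ex d' : exists l, bilateral_sum (fun k => g (2 * k + d')) l.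
  have s40 : s ^+ 4 != 0 by rewrite expf_neq0.
  have s41 : nm (s ^+ 4) < 1 by rewrite (nmX nmP) exprn_ilt1 // (nm_ge0 nmP).
  have y0 : x ^+ 2 * s ^ (4 * d') != 0 by rewrite mulf_neq0 ?expf_neq0 // expfz_neq0.
  eexists; apply: bsum_ext (bsumZ (g d') (jacobi_triple nmP s40 s41 y0)) _ erefl => k.
  rewrite /g [(x ^+ 2 * _) ^ k]expfzMl (exprnP s 4) (exprnP x 2) !exprz_exp.
  rewrite [(2 * k + d') ^+ 2](_ : _ = d' ^+ 2 + 4 * k ^+ 2 + 4 * d' * k); last by ring.
  by rewrite !expfzDr //; ring.
have [E0 HE0] := ex d; have [E1 HE1] := ex (d + 1).
have e1 : theta s x = E0 + E1.
  apply: (bsum_parity nmP H1) => //; apply: bsum_ext HE1 _ _ => // k.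
  by rewrite /g addrA (addrAC _ 1).
have e2 : theta (- s) x = (-1) ^ d * E0 + - (-1) ^ d * E1.
  apply: (bsum_parity nmP H2).
    apply: bsum_ext (bsumZ _ HE0) _ erefl => k /=.
    rewrite Nsg; congr (_ * _); rewrite expfzDr ?oppr_eq0 ?oner_eq0 //.
    by rewrite expN1_even mul1r.
  apply: bsum_ext (bsumZ _ HE1) _ erefl => k /=.
  rewrite Nsg addrAC addrA; congr (_ * _); rewrite !expfzDr ?oppr_eq0 ?oner_eq0 //.
  by rewrite expN1_even mul1r expr1z mulrN1.
apply: bsum_ext HE0 _ _ => //; rewrite e1 e2.
have dd : (-1) ^ d * (-1) ^ d = 1 :> K by rewrite -expfzMl mulrNN mulr1 exp1rz.
rewrite (_ : _ * (_ + _) = (-1) ^ d * (-1) ^ d * (E0 - E1)); last by ring.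
by rewrite dd; field.
Qed.

End Bilateral.

(** * The bilateral series as a combination of two theta functions *)

Section TwoTheta.
Variables (R : realType) (K : numFieldType) (nm : K -> R).
Hypothesis nmP : complete_abs nm.

Lemma nm_qprod_shift_le (a q : K) k M : q != 0 -> nm q < 1 ->
  nm (qprod (a / q ^+ k) q M) <=
  expR (nm a / (1 - nm q)) * \prod_(i < k) (1 + nm a / nm q ^+ i.+1).
Proof.
move=> q0 q1; apply: le_trans (nm_prod1B_le nmP _ _ q1) _.
rewrite (nmM nmP) (nmV nmP) (nmX nmP).
by apply: prod1D_shift_le; rewrite ?(nm_ge0 nmP) ?(nm_gt0 nmP).
Qed.

Lemma nm_qprod_mulX_le (a q : K) k M : nm q < 1 ->
  nm (qprod (a * q ^+ k) q M) <= expR (nm a / (1 - nm q)).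
Proof.
move=> q1; apply: le_trans (nm_qprod_le nmP _ _ q1) _.
rewrite ler_expR ler_wpM2r ?invr_ge0 ?subr_ge0 ?(ltW q1) // (nmM nmP) (nmX nmP).
by rewrite ler_piMr ?(nm_ge0 nmP) // exprn_ile1 ?(nm_ge0 nmP) // ltW.
Qed.

Section Fixed.
Variables (p x : K) (e : bool).
Hypotheses (p0 : p != 0) (p1 : nm p < 1) (x0 : x != 0).

Let q0 : p ^+ 2 != 0. Proof. by rewrite expf_neq0. Qed.
Let q1 : nm (p ^+ 2) < 1. Proof. exact: nm_sqr_lt1. Qed.

(** For k >= 0 the first product is bounded and the second contains negative powers of p; for k < 0
    the roles are exchanged. In both cases the quadratic exponent 2k(k + e) outweighs these powers
    by [gauss_prod_decay]. *)
Lemma jprod_geo_bounded :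
  zgeo_bounded nm (fun M k =>
    jprod p (x * p ^ (2 * k)) M * (p ^ (2 * k * (k + Posz e)) * x ^ (2 * k))).
Proof.
have r01 : 0 < nm p < 1 by rewrite (nm_gt0 nmP).
have r01' : 0 <= nm p < 1 by case/andP: r01 => /ltW -> ->.
have r_ge0 := nm_ge0 nmP p; have X_ge0 := nm_ge0 nmP x.
have X0 := nm_gt0 nmP x0.
split.
- pose E n := (2 * n * (n + e))%N.
  have HE n : (E n + 4 * n <= E n.+1)%N by rewrite /E; case: (e) => /=; lia.
  have c0 : 0 <= nm p / nm x by rewrite divr_ge0.
  have A0 : 0 <= nm x ^+ 2 by rewrite exprn_ge0.
  have [C HC] := gauss_prod_decay r01 A0 c0 HE.
  pose B1 := expR (nm (- (x * p ^+ 2)) / (1 - nm (p ^+ 2))).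
  pose B2 := expR (nm (- (p / x)) / (1 - nm (p ^+ 2))).
  exists (B1 * B2 * C), (nm p); split=> // M n.
  have E1 : - (x * p ^ (2 * Posz n) * p ^+ 2) = - (x * p ^+ 2) * (p ^+ 2) ^+ n.
    by rewrite (_ : p ^ (2 * Posz n) = (p ^+ 2) ^+ n); [ring | rewrite -exprM -exprnP].
  have E2 : - (p / (x * p ^ (2 * Posz n))) = - (p / x) / (p ^+ 2) ^+ n.
    rewrite (_ : p ^ (2 * Posz n) = (p ^+ 2) ^+ n); last by rewrite -exprM -exprnP.
    by field; rewrite x0 expf_neq0.
  rewrite /jprod E1 E2 !(nmM nmP).
  have h1 := nm_qprod_mulX_le (- (x * p ^+ 2)) n M q1; rewrite -/B1 in h1.
  have h2 := nm_qprod_shift_le (- (p / x)) n M q0 q1; rewrite -/B2 in h2.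
  have B10 : 0 <= B1 by exact: expR_ge0.
  have B20 : 0 <= B2 by exact: expR_ge0.
  have -> : nm (p ^ (2 * Posz n * (Posz n + Posz e))) = nm p ^+ E n.
    by rewrite (nmXz nmP).
  have -> : nm (x ^ (2 * Posz n)) = nm x ^+ 2 ^+ n by rewrite (nmXz nmP) -exprM.
  apply: (@le_trans _ _ (B1 * (B2 * \prod_(i < n) (1 + nm (- (p / x)) / nm (p ^+ 2) ^+ i.+1)) * (nm p ^+ E n * nm x ^+ 2 ^+ n))).
    rewrite ler_wpM2r ?mulr_ge0 ?exprn_ge0 //.
    by rewrite ler_pM ?(nm_ge0 nmP).
  rewrite (nmN nmP) (nmM nmP) (nmV nmP) (nmX nmP).
  have := ler_wpM2l (mulr_ge0 B10 B20) (HC n).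
  by rewrite !mulrA; apply: le_trans; rewrite le_eqVlt; apply/orP; left; apply/eqP; ring.
(* The exponent at k = -n. Truncated subtraction is harmless, since the factor 2n vanishes at n =
   0. *)
- pose E n := (2 * n * (n - e))%N.
  have HE n : (E n + 4 * n <= E n.+1)%N.
    by rewrite /E; case: (e) => /=; [case: n => // n|]; nia.
  have EZ m : Posz (E m) = 2 * Posz m * (Posz m - Posz e).
    by rewrite /E; case: (e); case: m => [|m]; rewrite ?subSS ?subn0 /=; lia.
  have c0 : 0 <= nm x * nm p ^+ 2 by rewrite mulr_ge0 ?exprn_ge0.
  have A0 : 0 <= (nm x)^-1 ^+ 2 by rewrite exprn_ge0 // invr_ge0.
  have [C HC] := gauss_prod_decay r01 A0 c0 HE.
  pose B1 := expR (nm (- (x * p ^+ 2)) / (1 - nm (p ^+ 2))).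
  pose B2 := expR (nm (- (p / x)) / (1 - nm (p ^+ 2))).
  exists (B1 * B2 * C * nm p), (nm p); split=> // M n.
  rewrite -[leRHS]mulrA -exprS; move: (n.+1) (NegzE n) => m ->.
  have Ep : p ^ (2 * - Posz m) = ((p ^+ 2) ^+ m)^-1.
    by rewrite mulrN -invr_expz -exprM.
  have E1 : - (x * p ^ (2 * - Posz m) * p ^+ 2) = - (x * p ^+ 2) / (p ^+ 2) ^+ m.
    by rewrite Ep; field; rewrite expf_neq0.
  have E2 : - (p / (x * p ^ (2 * - Posz m))) = - (p / x) * (p ^+ 2) ^+ m.
    by rewrite Ep; field; rewrite x0 expf_neq0.
  rewrite /jprod E1 E2 !(nmM nmP).
  have h1 := nm_qprod_shift_le (- (x * p ^+ 2)) m M q0 q1; rewrite -/B1 in h1.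
  have h2 := nm_qprod_mulX_le (- (p / x)) m M q1; rewrite -/B2 in h2.
  have B10 : 0 <= B1 by exact: expR_ge0.
  have B20 : 0 <= B2 by exact: expR_ge0.
  have -> : nm (p ^ (2 * - Posz m * (- Posz m + Posz e))) = nm p ^+ E m.
    by rewrite (nmXz nmP) (_ : _ * (_ + _) = Posz (E m)) // EZ; ring.
  have -> : nm (x ^ (2 * - Posz m)) = (nm x)^-1 ^+ 2 ^+ m.
    by rewrite (nmXz nmP) mulrN -invr_expz -!exprM exprVn.
  apply: (@le_trans _ _ (B1 * (\prod_(i < m) (1 + nm (- (x * p ^+ 2)) / nm (p ^+ 2) ^+ i.+1)) * B2 * (nm p ^+ E m * (nm x)^-1 ^+ 2 ^+ m))).
    rewrite ler_wpM2r ?mulr_ge0 ?exprn_ge0 ?invr_ge0 //.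
    by rewrite ler_pM ?(nm_ge0 nmP).
  rewrite (nmN nmP) (nmM nmP) (nmX nmP).
  have := ler_wpM2l (mulr_ge0 B10 B20) (HC m).
  by rewrite !mulrA; apply: le_trans; rewrite le_eqVlt; apply/orP; left; apply/eqP; ring.
Qed.

Variable s : K.
Hypotheses (s_ne0 : s != 0) (s_lt1 : nm s < 1) (sp : s ^+ 2 = p).

Let pX n : 1 - p ^+ 2 * (p ^+ 2) ^+ n != 0.
Proof. exact: (sub1X_neq0 nmP q1). Qed.

(** The exponent of s left over in [monomial_theta]. For e = 1 it has 2b instead of 2a, which
    exchanging a and b in the symmetric double sum undoes. *)
Let wt (a b : nat) := ((a + b) * (a + b) + 2 * (if e then b else a))%N.

Lemma theta_weightE (t : K) M : theta_weight t M = \sum_(a < M.+1) \sum_(b < M.+1)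
  gbin (t ^+ 4) M a * gbin (t ^+ 4) M b * t ^+ wt a b.
Proof.
rewrite /theta_weight /wt; case: e => //; rewrite exchange_big /=.
apply: eq_bigr => a _; apply: eq_bigr => b _.
by rewrite [(b + a)%N]addnC; ring.
Qed.

(** Completing the square in the exponent of s, where p = s^2: (2k + d)^2 absorbs 4k^2 and the cross
    term 4kd. For fixed a and b the sum over k thus runs through a theta series along a progression
    modulo 2. *)
Lemma monomial_theta (a b : nat) (k : int) (d := Posz a - Posz b) :
  s ^+ wt a b * (s ^ ((2 * k + d) ^+ 2) * (x * p ^+ e) ^ (2 * k + d)) =
  p ^ Posz (a * a + a + b * b) * (x * p ^ (2 * k)) ^ d *
    (p ^ (2 * k * (k + Posz e)) * x ^ (2 * k)).
Proof.
have pE (n : int) : p ^ n = s ^ (2 * n) by rewrite -sp exprnP exprz_exp.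
set N := 2 * k + d.
have L : s ^ Posz (wt a b) * s ^ (N ^+ 2) * s ^ (2 * (Posz e * N)) =
    s ^ (2 * Posz (a * a + a + b * b)) * s ^ (2 * (2 * k * d)) *
    s ^ (2 * (2 * k * (k + Posz e))).
  rewrite -!expfzDr //; congr (_ ^ _); rewrite /wt /N /d !PoszD !PoszM.
  by case: (e) => /=; ring.
rewrite !expfzMl (exprnP p e) (exprnP s (wt a b)) !exprz_exp !pE.
transitivity (s ^ Posz (wt a b) * s ^ (N ^+ 2) * s ^ (2 * (Posz e * N)) *
  (x ^ (2 * k) * x ^ d)).
  by rewrite /N expfzDr //; ring.
by rewrite L; ring.
Qed.

Lemma jprod_bsum M :
  bilateral_sum (fun k =>
      jprod p (x * p ^ (2 * k)) M * (p ^ (2 * k * (k + Posz e)) * x ^ (2 * k)))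
    (2^-1 * (theta_weight s M * theta s (x * p ^+ e) +
             theta_weight (- s) M * theta (- s) (x * p ^+ e))).
Proof.
have y0 : x * p ^+ e != 0 by rewrite mulf_neq0 // expf_neq0.
have s4 : s ^+ 4 = p ^+ 2 by rewrite -sp -exprM.
pose G a b := gbin (p ^+ 2) M a * gbin (p ^+ 2) M b.
pose d (a b : nat) : int := Posz a - Posz b.
have inner a b := bsumZ (G a b * s ^+ wt a b) (theta_progression nmP (d a b) s_ne0 s_lt1 y0).
have := bsum_sum M.+1 (fun a => bsum_sum M.+1 (fun b => inner a b)).
move/bsum_ext; apply.
- move=> k; rewrite jprodE //; last by rewrite mulf_neq0 // expfz_neq0.
  rewrite mulr_suml; apply: eq_bigr => a _; rewrite mulr_suml; apply: eq_bigr => b _.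
  by rewrite -[RHS]mulrA -monomial_theta /G -!mulrA.
- have wtE (t : K) (Th : K) : t ^+ 4 = p ^+ 2 -> theta_weight t M * Th =
      \sum_(a < M.+1) \sum_(b < M.+1) G a b * t ^+ wt a b * Th.
    move=> t4; rewrite theta_weightE t4 mulr_suml; apply: eq_bigr => a _.
    by rewrite mulr_suml.
  rewrite !wtE //; last by rewrite -s4; ring.
  rewrite -big_split mulr_sumr; apply: eq_bigr => a _ /=.
  rewrite -big_split mulr_sumr; apply: eq_bigr => b _ /=.
  (* The sign (-1)^d from [theta_progression] is absorbed here: [wt a b], a + b and a - b have the
     same parity. *)
  have -> : (- s) ^+ wt a b = s ^+ wt a b * (-1) ^ d a b; last by ring.
  rewrite exprNn mulrC; congr (_ * _).
  rewrite /d expfzDr ?oppr_eq0 ?oner_eq0 // -exprnN -exprnP.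
  rewrite -exprVn invrN1 -exprD -(signr_odd _ (wt a b)) -(signr_odd _ (a + b)).
  by rewrite /wt oddD !oddM andbb addbF.
Qed.

Lemma two_theta_bsum :
  bilateral_sum (fun k =>
      qpoch_inf (- (x * p ^ (2 * k) * p ^+ 2)) (p ^+ 2) *
      qpoch_inf (- (p / (x * p ^ (2 * k)))) (p ^+ 2) *
      (p ^ (2 * k * (k + Posz e)) * x ^ (2 * k)))
    (2^-1 * (qpoch_inf (- s) p * theta s (x * p ^+ e) +
             qpoch_inf s p * theta (- s) (x * p ^+ e))).
Proof.
have Ns0 : - s != 0 by rewrite oppr_eq0.
have Ns1 : nm (- s) < 1 by rewrite (nmN nmP).
have [] := bsum_tannery nmP jprod_geo_bounded (g := fun k =>
  qpoch_inf (- (x * p ^ (2 * k) * p ^+ 2)) (p ^+ 2) *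
  qpoch_inf (- (p / (x * p ^ (2 * k)))) (p ^+ 2) *
  (p ^ (2 * k * (k + Posz e)) * x ^ (2 * k))) _ jprod_bsum.
  move=> k; apply: cvgM; last exact: cvg_cst.
  by apply: cvgM; exact: (qpoch_inf_cvg nmP q1).
move=> lg gs lgs.
apply: bsum_ext gs _ _ => //; apply: (cvg_uniq lgs).
have c1 := theta_weight_cvg nmP s_ne0 s_lt1.
have c2 := theta_weight_cvg nmP Ns0 Ns1.
rewrite sqrrN opprK sp in c2; rewrite sp in c1.
apply: cvgM; first exact: cvg_cst.
by apply: cvgD; apply: cvgM => //; exact: cvg_cst.
Qed.

End Fixed.
End TwoTheta.

(** * Transformations of theta functions *)

Section ThetaAlgebra.
Variables (R : realType) (K : numFieldType) (nm : K -> R).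
Hypothesis nmP : complete_abs nm.

(** The term s^(k^2+2k) y^k is (ys)^-1 times the term of index k + 1. *)
Lemma theta_quasiperiod (s y : K) : s != 0 -> nm s < 1 -> y != 0 ->
  theta s (y * s ^+ 2) = (y * s)^-1 * theta s y.
Proof.
move=> s0 s1 y0; have ys0 : y * s ^+ 2 != 0 by rewrite mulf_neq0 ?expf_neq0.
apply: (bsum_uniq (jacobi_triple nmP s0 s1 ys0)).
apply: bsum_ext (bsumZ _ (bsum_shift nmP (jacobi_triple nmP s0 s1 y0))) _ erefl => k.
rewrite /= (_ : (k + 1) ^+ 2 = k ^+ 2 + 2 * k + 1); last by ring.
rewrite expfzMl (exprnP s 2) exprz_exp !expfzDr // !expr1z.
by field; rewrite s0 y0.
Qed.

(* Each factor on the left is an infinite product in base [s ^+ 2]; together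
   they interlace to products in base [s]. *)
Lemma theta_collapse (t x : K) (s := t ^+ 2) : t != 0 -> nm t < 1 -> x != 0 ->
  qpoch_inf (x * s ^+ 2) (s ^+ 2) * qpoch_inf x^-1 (s ^+ 2) *
    (qpoch_inf s (s ^+ 2) * theta (- s) x) = theta t (- (x * t)).
Proof.
move=> t0 t1 x0; have s1 : nm s < 1 by exact: nm_sqr_lt1.
rewrite /theta sqrrN -/s (_ : - (x * - s) = x * s); last by ring.
rewrite (_ : - (- s / x) = x^-1 * s); last by field.
rewrite (_ : - (- (x * t) * t) = x * s); last by rewrite /s; ring.
rewrite (_ : - (t / - (x * t)) = x^-1); last by field; rewrite t0 x0.
rewrite (qpoch_inf_dissect nmP s s1) (qpoch_inf_dissect nmP (x * s) s1).
rewrite (qpoch_inf_dissect nmP x^-1 s1) -expr2 -[x * s * s]mulrA -expr2.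
by ring.
Qed.

(** The series of [theta t (- (x * t))] has terms (-x)^j t^(j^2+j). Passing to i t multiplies them
    by i^(j^2+j), which is 1 for j = 0, 3 and -1 for j = 1, 2 modulo 4. Splitting twice by parity
    isolates the four classes. *)
Lemma theta_dissect4 (t i x : K) (p := t ^+ 4) :
  i ^+ 2 = -1 -> nm i = 1 -> t != 0 -> nm t < 1 -> x != 0 ->
  theta t (- (x * t)) + theta (i * t) (- (x * (i * t))) =
  2 * (theta (p ^+ 4) (x ^+ 4 * p) - x^-1 * theta (p ^+ 4) (x ^+ 4 / p)).
Proof.
move=> i2 ni t0 t1 x0.
have i0 : i != 0 by rewrite -(nm_eq0 nmP) ni oner_eq0.
have it0 : i * t != 0 by rewrite mulf_neq0.
have it1 : nm (i * t) < 1 by rewrite (nmM nmP) ni mul1r.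
have y0 : - (x * t) != 0 by rewrite oppr_eq0 mulf_neq0.
have iy0 : - (x * (i * t)) != 0 by rewrite oppr_eq0 !mulf_neq0.
have p0 : p != 0 by rewrite expf_neq0.
have s0 : p ^+ 4 != 0 by rewrite expf_neq0.
have s1 : nm (p ^+ 4) < 1 by rewrite -exprM (nmX nmP) exprn_ilt1 // (nm_ge0 nmP).
have a0 : x ^+ 4 * p != 0 by rewrite mulf_neq0 // expf_neq0.
have b0 : x ^+ 4 / p != 0 by rewrite mulf_neq0 ?invr_eq0 // expf_neq0.
pose J (u : K) (j : int) := u ^ (j ^+ 2) * (- (x * u)) ^ j.
pose f j := J t j + J (i * t) j.
have JE u j : u != 0 -> J u j = (- x) ^ j * u ^ (j ^+ 2 + j).
  by move=> u0; rewrite /J -mulNr expfzMl expfzDr //; ring.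
have fE j : f j = (- x) ^ j * t ^ (j ^+ 2 + j) * (1 + i ^ (j ^+ 2 + j)).
  by rewrite /f !JE // expfzMl; ring.
have i4 (k : int) : i ^ (4 * k) = 1.
  by rewrite -exprz_exp -exprnP (_ : i ^+ 4 = 1) ?exp1rz // (exprM i 2 2) i2 sqrrN expr1n.
have prog d := bsumD (theta_progression nmP d t0 t1 y0) (theta_progression nmP d it0 it1 iy0).
have H := bsumD (jacobi_triple nmP t0 t1 y0) (jacobi_triple nmP it0 it1 iy0).
rewrite -/(theta _ _) -/(theta _ _) in H.
have pE (n : int) : p ^ n = t ^ (4 * n) by rewrite /p exprnP exprz_exp.
have x4 (k : int) : (- x) ^ (4 * k) = x ^ (4 * k).
  by rewrite -!exprz_exp -!exprnP; congr (_ ^ _); ring.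
have f0 : bilateral_sum (fun k => f (2 * (2 * k))) (2 * theta (p ^+ 4) (x ^+ 4 * p)).
  apply: bsum_ext (bsumZ 2 (jacobi_triple nmP s0 s1 a0)) _ erefl => k.
  rewrite fE (_ : (2 * (2 * k)) ^+ 2 + 2 * (2 * k) = 4 * (4 * k ^+ 2 + k)); last by ring.
  rewrite i4 -pE mulrA (_ : 2 * 2 = 4) // x4 [(x ^+ 4 * p) ^ k]expfzMl (exprnP p 4) (exprnP x 4) !exprz_exp.
  by rewrite expfzDr //; ring.
have f2 : bilateral_sum (fun k => f (2 * (2 * k + 1))) 0.
  apply: bsum_ext (@bsum0 K) _ erefl => k.
  rewrite fE (_ : (2 * (2 * k + 1)) ^+ 2 + 2 * (2 * k + 1) = 4 * (4 * k ^+ 2 + 5 * k + 1) + 2); last by ring.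
  by rewrite (expfzDr _ _ i0) i4 mul1r -exprnP i2 subrr mulr0.
have f1 : bilateral_sum (fun k => f (2 * (2 * k) + 1)) 0.
  apply: bsum_ext (@bsum0 K) _ erefl => k.
  rewrite fE (_ : (2 * (2 * k) + 1) ^+ 2 + (2 * (2 * k) + 1) = 4 * (4 * k ^+ 2 + 3 * k) + 2); last by ring.
  by rewrite (expfzDr _ _ i0) i4 mul1r -exprnP i2 subrr mulr0.
(* The index 4k + 3 is 4(k + 1) - 1, so the theta series enters shifted by one. *)
have f3 : bilateral_sum (fun k => f (2 * (2 * k + 1) + 1)) (- 2 * x^-1 * theta (p ^+ 4) (x ^+ 4 / p)).
  apply: bsum_ext (bsumZ (- 2 * x^-1) (bsum_shift nmP (jacobi_triple nmP s0 s1 b0))) _ erefl => k.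
  rewrite fE (_ : (2 * (2 * k + 1) + 1) ^+ 2 + (2 * (2 * k + 1) + 1) = 4 * (4 * (k + 1) ^+ 2 - (k + 1))); last by ring.
  rewrite i4 -pE (_ : 2 * (2 * k + 1) + 1 = 4 * (k + 1) - 1); last by ring.
  rewrite [(- x) ^ (_ - 1)]expfzDr ?oppr_eq0 // x4 (_ : (- x) ^ (-1) = - x^-1); last by rewrite exprN1 invrN.
  rewrite [(x ^+ 4 / p) ^ _]expfzMl (exprnP p 4) (exprnP x 4) !exprz_exp exprz_inv.
  by rewrite [p ^ (_ - _)]expfzDr //; ring.
have even := bsum_ext (g := fun k => f (2 * k)) (prog 0)
  (fun k => congr1 f (addr0 (2 * k))) erefl.
rewrite (bsum_parity (f := f) nmP H even (prog 1)).
rewrite (bsum_parity (f := fun k => f (2 * k)) nmP even f0 f2).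
by rewrite (bsum_parity (f := fun k => f (2 * k + 1)) nmP (prog 1) f1 f3); ring.
Qed.

End ThetaAlgebra.

(** * Evaluation of the original bilateral series *)

Lemma qpoch_posS (K : fieldType) (a q : K) (n : nat) :
  qpoch a q (Posz n.+1) = qpoch a q (Posz n) * (1 - a * q ^ Posz n).
Proof. by rewrite !qpoch_pos qprodS. Qed.

Lemma qpoch_negS (K : fieldType) (a q : K) (n : nat) : qpoch_neg_defined a q ->
  qpoch a q (- Posz n) = qpoch a q (- Posz n.+1) * (1 - a * q ^ (- Posz n.+1)).
Proof.
case=> q0 /(_ n.+1 isT) h; rewrite -[- Posz n.+1]NegzE.
have -> : qpoch a q (- Posz n) = \prod_(1 <= j < n.+1) (1 - a * q ^- j)^-1.
  by case: n {h} => [|n] //; rewrite oppr0 /= !big_geq.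
have -> : qpoch a q (Negz n) = \prod_(1 <= j < n.+2) (1 - a * q ^- j)^-1 by [].
by rewrite [in RHS]big_nat_recr //= -mulrA mulVf ?mulr1.
Qed.

Section Identity.
Variables (R : realType) (K : numFieldType) (nm : K -> R).
Hypothesis nmP : complete_abs nm.

(** The squares of i t and t are -s and s, so [theta_collapse] at these two points turns the
    summands into the left side of [theta_dissect4]. *)
Lemma two_theta_value (t i x : K) (s := t ^+ 2) (p := t ^+ 4) :
  i ^+ 2 = -1 -> nm i = 1 -> t != 0 -> nm t < 1 -> x != 0 ->
  qpoch_inf (x * p) p * qpoch_inf x^-1 p *
    (2^-1 * (qpoch_inf (- s) p * theta s x + qpoch_inf s p * theta (- s) x)) =
  theta (p ^+ 4) (x ^+ 4 * p) - x^-1 * theta (p ^+ 4) (x ^+ 4 / p).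
Proof.
move=> i2 ni t0 t1 x0.
have it0 : i * t != 0 by rewrite mulf_neq0 // -(nm_eq0 nmP) ni oner_eq0.
have it1 : nm (i * t) < 1 by rewrite (nmM nmP) ni mul1r.
have sp : s ^+ 2 = p by rewrite /s -exprM.
have E1 := theta_collapse nmP t0 t1 x0; rewrite -/s sp in E1.
have E2 := theta_collapse nmP it0 it1 x0.
have its : (i * t) ^+ 2 = - s by rewrite exprMn i2 mulN1r.
rewrite its sqrrN opprK sp in E2.
have := theta_dissect4 nmP i2 ni t0 t1 x0; rewrite -E1 -E2 -/p => H.
by apply: (mulfI (x := 2)); rewrite ?pnatr_eq0 // -H; field.
Qed.

Section Fixed.
Variables q z : K.
Hypotheses (q1 : nm q < 1) (q0 : q != 0) (z0 : z != 0).
Hypothesis hnum : qpoch_neg_defined (- z * q) (q ^+ 2).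
Hypothesis hden : qpoch_neg_defined (z * q ^+ 2) (q ^+ 2).
Hypothesis hden0 : forall k : int, qpoch (z * q ^+ 2) (q ^+ 2) k != 0.

Let Q0 : q ^+ 2 != 0. Proof. by rewrite expf_neq0. Qed.
Let Q1 : nm (q ^+ 2) < 1. Proof. exact: nm_sqr_lt1. Qed.

(** [W] is the tail of (zq^2;q^2)_oo after k factors and [U] its counterpart for the reversed
    numerator. Multiplying by [W 0 * U 0] removes the finite products for k of either sign. *)
Let W (k : int) := qpoch_inf (z * q ^+ 2 * (q ^+ 2) ^ k) (q ^+ 2).
Let U (k : int) := qpoch_inf (- (q / z) / (q ^+ 2) ^ k) (q ^+ 2).

Lemma qpoch_den_shift k : W 0 = qpoch (z * q ^+ 2) (q ^+ 2) k * W k.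
Proof.
have WS j : W j = (1 - z * q ^+ 2 * (q ^+ 2) ^ j) * W (j + 1).
  by rewrite /W (qpoch_infS nmP _ Q1) expfzDr // expr1z !mulrA.
elim/int_ind: k => [|n IH|n IH].
- by rewrite qpoch_pos qprod0 mul1r.
- rewrite IH WS qpoch_posS mulrA; congr (_ * W _); lia.
- rewrite IH qpoch_negS // -mulrA; congr (_ * _).
  by rewrite [W (- n.+1%:Z)]WS; congr (_ * W _); lia.
Qed.

(** Each factor 1 + z q^(2j+1) equals z q^(2j+1) (1 + q^(-2j-1) / z); for k > 0 the extracted
    monomials multiply to z^k q^(k^2). *)
Lemma qpoch_num_shift k :
  qpoch (- z * q) (q ^+ 2) k * U 0 = z ^ k * q ^ (k ^+ 2) * U k.
Proof.
have US j : z * q * (q ^+ 2) ^ j * U (j + 1) = (1 - - z * q * (q ^+ 2) ^ j) * U j.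
  have h : (q ^+ 2) ^ j != 0 by rewrite expfz_neq0.
  rewrite /U (qpoch_infS nmP (- (q / z) / _) Q1) expfzDr // expr1z.
  rewrite (_ : - (q / z) / ((q ^+ 2) ^ j * q ^+ 2) * q ^+ 2 = - (q / z) / (q ^+ 2) ^ j); last first.
    by field; rewrite q0 z0 h.
  by field; rewrite q0 z0 h.
have zq j : z ^ (j + 1) * q ^ ((j + 1) ^+ 2) = z ^ j * q ^ (j ^+ 2) * (z * q * (q ^+ 2) ^ j).
  rewrite (_ : (j + 1) ^+ 2 = j ^+ 2 + 2 * j + 1); last by ring.
  by rewrite !expfzDr // !expr1z [(q ^+ 2) ^ j](exprz_exp q 2 j); ring.
elim/int_ind: k => [|n IH|n IH].
- by rewrite qpoch_pos qprod0 mul1r expr0z expr0n /= expr0z !mul1r.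
- have -> : Posz n.+1 = Posz n + 1 by lia.
  rewrite zq -mulrA US [in RHS]mulrA mulrAC -IH -[Posz n + 1]/(Posz (n + 1)) addn1 qpoch_posS.
  by ring.
- have ne : 1 - - z * q * (q ^+ 2) ^ (- n.+1%:Z) != 0.
    by have [_ /(_ n.+1 isT)] := hnum; rewrite -exprnN.
  apply: (mulIf ne); rewrite mulrAC -qpoch_negS // IH.
  have -> : - n%:Z = - n.+1%:Z + 1 by lia.
  by rewrite zq -mulrA US; ring.
Qed.

(** The monomial z^k q^(k^2) coming from the numerator doubles the powers already present, so all
    exponents of q and z outside the products become even and the signs in p = -q, x = -z
    disappear. *)
Lemma series_term (e : bool) k (p := - q) (x := - z) :
  W 0 * U 0 * (qpoch (- z * q) (q ^+ 2) k / qpoch (z * q ^+ 2) (q ^+ 2) k *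
    q ^ (k * (k + 2 * Posz e)) * z ^ k) =
  qpoch_inf (- (x * p ^ (2 * k) * p ^+ 2)) (p ^+ 2) *
  qpoch_inf (- (p / (x * p ^ (2 * k)))) (p ^+ 2) *
  (p ^ (2 * k * (k + Posz e)) * x ^ (2 * k)).
Proof.
have Ne (y : K) (j : int) : (- y) ^ (2 * j) = y ^ (2 * j).
  by rewrite -!exprz_exp -!exprnP sqrrN.
have Ek (y : K) : y ^ (2 * k) = (y ^+ 2) ^ k by rewrite (exprnP y 2) exprz_exp.
rewrite /p /x sqrrN (_ : 2 * k * (k + Posz e) = 2 * (k * (k + Posz e))); last by ring.
rewrite !Ne (Ek q).
have h : (q ^+ 2) ^ k != 0 by rewrite expfz_neq0.
rewrite (_ : - (- z * (q ^+ 2) ^ k * q ^+ 2) = z * q ^+ 2 * (q ^+ 2) ^ k); last by ring.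
rewrite (_ : - (- q / (- z * (q ^+ 2) ^ k)) = - (q / z) / (q ^+ 2) ^ k); last by field; rewrite z0 h.
rewrite -/(W k) -/(U k) (qpoch_den_shift k).
transitivity (qpoch (- z * q) (q ^+ 2) k * U 0 * W k * q ^ (k * (k + 2 * Posz e)) * z ^ k).
  by field; exact: hden0.
rewrite qpoch_num_shift.
rewrite (_ : 2 * (k * (k + Posz e)) = k ^+ 2 + k * (k + 2 * Posz e)); last by ring.
rewrite (_ : 2 * k = k + k); last by ring.
by rewrite !expfzDr //; ring.
Qed.

Variables t i : K.
Hypotheses (i2 : i ^+ 2 = -1) (ni : nm i = 1) (t4 : t ^+ 4 = - q).
Hypothesis hprod : qpoch_infs [:: z ^+ 2 * q ^+ 2; 1 / z ^+ 2] (q ^+ 2) != 0.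

Let D := qpoch_inf (z * q) (- q) * qpoch_inf (- z^-1) (- q).

(** By (a^2;q^2)_oo = (a;q)_oo (-a;q)_oo and parity dissection, both sides are the same eight
    products in base q^2. Hence [hprod] makes [W 0] and [U 0] nonzero, which permits dividing by the
    multiplier. *)
Lemma denominator_split :
  qpoch_infs [:: z ^+ 2 * q ^+ 2; 1 / z ^+ 2] (q ^+ 2) =
  qpoch_infs [:: - z * q; 1 / z] (q ^+ 2) * (W 0 * U 0) * D.
Proof.
rewrite /qpoch_infs !big_cons big_nil !mulr1 /D /W /U !expr0z divr1 !mulr1 -exprMn.
have Nq1 : nm (- q) < 1 by rewrite (nmN nmP).
rewrite (_ : 1 / z ^+ 2 = z^-1 ^+ 2); last by field.
rewrite !(qpoch_inf_sqr nmP _ q1) ![qpoch_inf _ q](qpoch_inf_dissect nmP _ q1).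
rewrite ![qpoch_inf _ (- q)](qpoch_inf_dissect nmP _ Nq1) sqrrN.
rewrite mul1r !mulNr !mulrN !opprK -![z * q * q]mulrA -!expr2 ![z^-1 * q]mulrC.
by ring.
Qed.

Lemma general_identity (e : bool) :
  bilateral_sum (fun k : int =>
      qpoch (- z * q) (q ^+ 2) k / qpoch (z * q ^+ 2) (q ^+ 2) k *
      q ^ (k * (k + 2 * Posz e)) * z ^ k)
    (qpoch_infs [:: - z * q; 1 / z] (q ^+ 2) /
     qpoch_infs [:: z ^+ 2 * q ^+ 2; 1 / z ^+ 2] (q ^+ 2) *
     if e then theta (q ^+ 4) (- (z ^+ 4 * q ^+ 3)) + z ^- 3 * theta (q ^+ 4) (- (z ^+ 4 / q ^+ 3))
     else theta (q ^+ 4) (- (z ^+ 4 * q)) + z^-1 * theta (q ^+ 4) (- (z ^+ 4 / q))).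
Proof.
have := hprod; rewrite denominator_split => h0.
have /and4P[c0 W0 U0 D0] : [&& qpoch_infs [:: - z * q; 1 / z] (q ^+ 2) != 0,
    W 0 != 0, U 0 != 0 & D != 0].
  by move: h0; rewrite !mulf_eq0 !negb_or => /andP[/andP[-> /andP[-> ->]] ->].
have t0 : t != 0.
  by apply: contraNneq q0 => tt; rewrite -oppr_eq0 -t4 tt expr0n.
have t1 : nm t < 1.
  rewrite -(@expr_lt1 _ 4) ?(nm_ge0 nmP) // -(nmX nmP) t4 (nmN nmP) //.
have p0 : - q != 0 by rewrite oppr_eq0.
have p1 : nm (- q) < 1 by rewrite (nmN nmP).
have x0 : - z != 0 by rewrite oppr_eq0.
have s0 : t ^+ 2 != 0 by rewrite expf_neq0.
have s1 : nm (t ^+ 2) < 1 by exact: nm_sqr_lt1.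
have sp : (t ^+ 2) ^+ 2 = - q by rewrite -exprM t4.
have T := two_theta_bsum nmP e p0 p1 x0 s0 s1 sp.
have y0 : - z * (- q) ^+ e != 0 by rewrite mulf_neq0 // expf_neq0.
have V := two_theta_value i2 ni t0 t1 y0.
rewrite t4 in V.
set v := _ * (_ + _) in T V.
have {T} := bsumZ (W 0 * U 0)^-1 T.
move/bsum_ext; apply.
  by move=> k /=; rewrite -series_term mulrA mulVf ?mul1r // mulf_neq0.
(* For e = 1 the theta argument is x p = zq, and the two prefactors in V differ from those in D by
   one step of the product recurrence each. *)
case: e {y0} v V => v V /=.
  rewrite expr1 mulrNN in V.
  pose a := qpoch_inf (z * q * - q) (- q); pose b := qpoch_inf (- z^-1) (- q).
  have Da : D = (1 - z * q) * a * b by rewrite /D (qpoch_infS nmP (z * q) p1).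
  have Db : qpoch_inf (z * q * - q) (- q) * qpoch_inf (z * q)^-1 (- q) =
      a * ((1 - (z * q)^-1) * b).
    rewrite [in LHS](qpoch_infS nmP (z * q)^-1 p1); do 2! congr (_ * _).
    by congr qpoch_inf; field; rewrite z0 q0.
  have s40 : q ^+ 4 != 0 by rewrite expf_neq0.
  have s41 : nm (q ^+ 4) < 1 by rewrite (nmX nmP) exprn_ilt1 // (nm_ge0 nmP).
  have y0 : - (z ^+ 4 / q ^+ 3) != 0.
    by rewrite oppr_eq0 mulf_neq0 ?invr_eq0 ?expf_neq0.
  (* The argument -z^4 q^5 is -z^4 / q^3 shifted by one period (q^4)^2. *)
  have qp := theta_quasiperiod nmP s40 s41 y0.
  rewrite Db (_ : (- q) ^+ 4 = q ^+ 4) in V; last by ring.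
  rewrite (_ : (z * q) ^+ 4 * - q = - (z ^+ 4 / q ^+ 3) * (q ^+ 4) ^+ 2) in V; last by field.
  rewrite qp (_ : (z * q) ^+ 4 / - q = - (z ^+ 4 * q ^+ 3)) in V; last by field.
  move: (theta _ _) (theta _ _) V => A B V.
  have -> : A + z ^- 3 * B = D * v.
    (* The factor -zq turns 1 - (zq)^-1, as found in V, into the 1 - zq of D. *)
    transitivity (- (z * q) * ((- (z ^+ 4 / q ^+ 3) * q ^+ 4)^-1 * B - (z * q)^-1 * A)).
      by field; rewrite z0 q0.
    by rewrite -V Da; field; rewrite z0 q0.
  by field; rewrite c0 W0 U0 D0.
rewrite expr0 mulr1 mulrNN invrN (_ : (- q) ^+ 4 = q ^+ 4) in V; last by ring.
rewrite (_ : (- z) ^+ 4 * - q = - (z ^+ 4 * q)) in V; last by ring.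
rewrite (_ : (- z) ^+ 4 / - q = - (z ^+ 4 / q)) in V; last by field.
rewrite mulNr opprK -/D in V.
by rewrite -V; field; rewrite c0 W0 U0 D0.
Qed.

End Fixed.
End Identity.

(** * Specialization to the complex numbers *)

Theorem theorem2p4 (R : realType) (q z : R[i])
    (hq : `|q| < 1) (hq0 : q != 0) (hz : z != 0)
    (hnum : qpoch_neg_defined (- z * q) (q ^+ 2))
    (hden : qpoch_neg_defined (z * q ^+ 2) (q ^+ 2))
    (hden0 : forall k : int, qpoch (z * q ^+ 2) (q ^+ 2) k != 0)
    (hprod : qpoch_infs [:: z ^+ 2 * q ^+ 2; 1 / z ^+ 2] (q ^+ 2) != 0) :
  bilateral_sum
    (fun k : int => qpoch (- z * q) (q ^+ 2) k / qpoch (z * q ^+ 2) (q ^+ 2) k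
                    * q ^ (k ^+ 2) * z ^ k)
    (qpoch_infs [:: - z * q; 1 / z] (q ^+ 2)
     / qpoch_infs [:: z ^+ 2 * q ^+ 2; 1 / z ^+ 2] (q ^+ 2)
     * qpoch_inf (q ^+ 8) (q ^+ 8)
     * (qpoch_infs [:: z ^+ 4 * q ^+ 5; z ^- 4 * q ^+ 3] (q ^+ 8)
        + z^-1 * qpoch_infs [:: z ^+ 4 * q ^+ 3; z ^- 4 * q ^+ 5] (q ^+ 8)))
  /\
  bilateral_sum
    (fun k : int => qpoch (- z * q) (q ^+ 2) k / qpoch (z * q ^+ 2) (q ^+ 2) k
                    * q ^ (k * (k + 2)) * z ^ k)
    (qpoch_infs [:: - z * q; 1 / z] (q ^+ 2)
     / qpoch_infs [:: z ^+ 2 * q ^+ 2; 1 / z ^+ 2] (q ^+ 2)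
     * qpoch_inf (q ^+ 8) (q ^+ 8)
     * (qpoch_infs [:: z ^+ 4 * q ^+ 7; z ^- 4 * q] (q ^+ 8)
        + z ^- 3 * qpoch_infs [:: z ^+ 4 * q; z ^- 4 * q ^+ 7] (q ^+ 8))).
Proof.
have nmP := cabs_complete R.
have q1 : cabs q < 1 by move: hq; rewrite norm_cabs -[1](rmorph1 (real_complex R)) ltcR.
have i2 := sqr_i R.
have ni : cabs ('i : R[i]) = 1 by rewrite /cabs /= expr0n expr1n add0r sqrtr1.
(* A fourth root t of p = -q; its square is the s of the two-theta formula. *)
have t4 : sqrtc (sqrtc (- q)) ^+ 4 = - q.
  by rewrite (exprM _ 2 2) !sqr_sqrtc.
have G := general_identity nmP q1 hq0 hz hnum hden hden0 i2 ni t4 hprod.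
(* For u = q^4 the products are in base u^2 = q^8, as in the stated right-hand sides. *)
have thetaE (K : numFieldType) (u y a b : K) : - (y * u) = a -> - (u / y) = b ->
    theta u y = qpoch_inf (u ^+ 2) (u ^+ 2) * qpoch_infs [:: a; b] (u ^+ 2).
  by move=> <- <-; rewrite /theta /qpoch_infs !big_cons big_nil mulr1.
have factor (K : comNzRingType) (c P A B w : K) :
    c * (P * A + w * (P * B)) = c * P * (A + w * B) by ring.
split.
- apply: bsum_ext (G false) _ _.
    by move=> k /=; rewrite mulr0 addr0 expr2.
  rewrite (thetaE _ _ _ (z ^+ 4 * q ^+ 5) (z ^- 4 * q ^+ 3)); [|by ring|by field; rewrite hz hq0].
  rewrite (thetaE _ _ _ (z ^+ 4 * q ^+ 3) (z ^- 4 * q ^+ 5)); [|by field|by field; rewrite hz hq0].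
  by rewrite -exprM factor.
- apply: bsum_ext (G true) _ _; first by move=> k /=; rewrite mulr1.
  rewrite (thetaE _ _ _ (z ^+ 4 * q ^+ 7) (z ^- 4 * q)); [|by ring|by field; rewrite hz hq0].
  rewrite (thetaE _ _ _ (z ^+ 4 * q) (z ^- 4 * q ^+ 7)); [|by field|by field; rewrite hz hq0].
  by rewrite -exprM factor.
Qed.
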